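(* Let $q\in\mathbb{C}^*$ with $|q|<1$, $E_q=\mathbb{C}^*/q^{\mathbb{Z}}$, $\eta\in\mathbb{C}^*$, $k\ge1$ an integer, and let $\xi_0$ be the degree $k$ line bundle on $E_q$ with multiplier $(\eta z)^k$. Let $m,n\in\{0,\dots,2k-1\}$ and let $x=x_0+x_1z+\cdots+x_{2k-1}z^{2k-1}\neq 0$ represent a class $[x]\in H^1(E_q,\xi_0^{\otimes -2})=\mathrm{Ext}^1(\xi_0,\xi_0^* )$ with $x_m=x_n=0$. Then the Poisson bracket on $(\mathrm{Ext}^1(\xi_0,\xi_0^* )\setminus\{0\})/\mathbb{C}^*=\mathbb{P}^{2k-1}$, the space of $\mathrm{SL}_2$-parabolic bundles lifting $\xi_0$ (trivial extension removed), satisfies $$\big\langle B^\#_{[x]}(d\vartheta_{-m}),d\vartheta_{-n}\big\rangle=\sum_{u\neq0}\ \sum_{l,t\in\mathbb{Z}}\frac{q^u+1}{q^u-1}\,q^{-(ml+nt)}\,q^{k[l(l-1)+t(t-1)]}\,\eta^{2k(l+t)}\,x_{m+u-2kl}\;x_{n-u-2kt},$$ where $u$ runs over nonzero integers and $x_j:=0$ for $j\notin\{0,\dots,2k-1\}$.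
   Context: $\mathcal{R}$ is the ring of holomorphic functions on $\mathbb{C}^*$, $f_q(z):=f(qz)$. $H^0(E_q,\xi_0^{\otimes 2})=\{f\in\mathcal{R}:(\eta z)^{2k}f_q=f\}$ and $H^1(E_q,\xi_0^{\otimes-2})=\mathcal{R}/\{(\eta z)^{-2k}f_q-f\}$, with basis $[1],[z],\dots,[z^{2k-1}]$. The Serre pairing of $\vartheta\in H^0(E_q,\xi_0^{\otimes2})$ with $[f]$ is the constant Laurent coefficient of $\vartheta f$. Set $$\vartheta_{-m}=\sum_{l\in\mathbb{Z}}q^{-ml}q^{kl(l-1)}\eta^{2kl}z^{2kl-m}\in H^0(E_q,\xi_0^{\otimes 2}),$$ so that the pairing of $\vartheta_{-m}$ with $[z^j]$ is $\delta_{mj}$ for $0\le j\le 2k-1$. The class $[x]$ corresponds to the extension $0\to\xi_0^*\to V\to\xi_0\to0$ with multiplier $\begin{pmatrix}(\eta z)^{-k}&0\\(\eta z)^kx&(\eta z)^k\end{pmatrix}$, i.e. $V$ has sections the row vectors $\mathbf f$ with $\mathbf f(qz)\cdot(\text{multiplier})=\mathbf f(z)$. Let $\mathfrak{g}(\xi)=\underline{\mathrm{End}}_0(V)$ be the traceless endomorphisms, $\mathfrak{p}(\xi)$ those preserving the flag, $\mathfrak{u}(\xi)=\underline{\mathrm{Hom}}(\xi_0,\xi_0^* )$, $\mathfrak{p}_-(\xi)=\mathfrak{g}(\xi)/\mathfrak{u}(\xi)$, $\mathfrak{u}_-(\xi)=\mathfrak{g}(\xi)/\mathfrak{p}(\xi)$.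 The moduli space of parabolic bundles has tangent space $H^1(E_q,\mathfrak{p}(\xi))$ and cotangent space $H^0(E_q,\mathfrak{p}_-(\xi))$ at this point, and its Poisson bivector is $B^\#=\delta\circ\tau:H^0(\mathfrak{p}_-(\xi))\to H^0(\mathfrak{u}_-(\xi))\to H^1(\mathfrak{p}(\xi))$, where $\tau$ is induced by the projection and $\delta$ is the connecting map of $0\to\mathfrak{p}(\xi)\to\mathfrak{g}(\xi)\to\mathfrak{u}_-(\xi)\to0$. Concretely $H^0(\mathfrak{p}_-(\xi))$ consists of matrices $\begin{pmatrix}a&b\\0&-a\end{pmatrix}$ with $a,b\in\mathcal{R}$, $(\eta z)^{2k}b_q=b$, $a_q-a=-bx$, and the pairing $\langle\cdot,\cdot\rangle$ between $H^1(\mathfrak{p}(\xi))$ and $H^0(\mathfrak{p}_-(\xi))$ is the constant Laurent coefficient of the trace of the product of representatives. When $x_m=0$, the constant term of $\vartheta_{-m}x$ vanishes and the cotangent vector $d\vartheta_{-m}$ at $[x]$ is the element of $H^0(\mathfrak{p}_-(\xi))$ with $b=\vartheta_{-m}$ (and $a$ any solution of $a_q-a=-\vartheta_{-m}x$; the choice does not affect the bracket when $x_n=0$); similarly for $d\vartheta_{-n}$. *)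

(* Defs.v *)
From Stdlib Require Export Reals ZArith List Lra Lia.
From Coquelicot Require Export Coquelicot.
Export ListNotations.

Open Scope C_scope.

Definition Cpowz (z : C) (n : Z) : C :=
  match n with
  | Z0 => 1
  | Zpos p => z ^ Pos.to_nat p
  | Zneg p => / (z ^ Pos.to_nat p)
  end.

Notation "z ^^ n" := (Cpowz z n%Z) (at level 30, right associativity) : C_scope.

(* Unconditional sum of the family [f] over the index set [A]: limit of the
   finite partial sums along the finite subsets of [A] ordered by inclusion,
   finite subsets being duplicate-free lists. *)
Definition lsum {I : Type} (f : I -> C) (F : list I) : C :=
  fold_right Cplus 0 (map f F).

Definition has_sum {I : Type} (A : I -> Prop) (f : I -> C) (s : C) : Prop :=
  forall eps : R, (0 < eps)%R ->
  exists F0 : list I, List.Forall A F0 /\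
    forall F : list I, NoDup F -> List.Forall A F -> incl F0 F ->
      (Cmod (lsum f F - s) < eps)%R.

(* Functions on C^* are functions on C whose value at 0 is ignored: every
   condition and every equality below is imposed for z <> 0 only. *)
Definition holomorphic (f : C -> C) : Prop :=
  forall z : C, z <> 0 -> ex_derive (K := C_AbsRing) (V := C_NormedModule) f z.

Definition laurent_expansion (f : C -> C) (a : Z -> C) : Prop :=
  forall z : C, z <> 0 ->
    has_sum (fun _ : Z => True) (fun j : Z => a j * z ^^ j) (f z).

Definition constant_coeff (f : C -> C) (c : C) : Prop :=
  exists a : Z -> C, laurent_expansion f a /\ a 0%Z = c.

Notation M2 := (@matrix C 2 2).

Definition entry (A : M2) (i j : nat) : C := coeff_mat (0 : C) A i j.

Definition mat2 (a b c d : C) : M2 :=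
  mk_matrix 2 2 (fun i j =>
    match i, j with
    | O, O => a
    | O, _ => b
    | _, O => c
    | _, _ => d
    end).

Definition mmul (A B : M2) : M2 := Mmult (T := C_Ring) A B.
Definition madd (A B : M2) : M2 := Mplus (G := C_AbelianGroup) A B.
Definition mopp (A : M2) : M2 :=
  mk_matrix 2 2 (fun i j => - entry A i j).
Definition msub (A B : M2) : M2 := madd A (mopp B).
Definition mtrace (A : M2) : C := entry A 0 0 + entry A 1 1.

(* The coefficient x_j, with x_j = 0 outside 0 <= j <= 2k-1. *)
Definition coef (k : nat) (x : nat -> C) (j : Z) : C :=
  if ((0 <=? j)%Z && (j <? 2 * Z.of_nat k)%Z)%bool then x (Z.to_nat j) else 0.

(* The polynomial x_0 + x_1 z + ... + x_{2k-1} z^{2k-1}. *)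
Definition xpoly (k : nat) (x : nat -> C) (z : C) : C :=
  lsum (fun j : nat => x j * z ^ j) (seq 0 (2 * k)).

(* Multiplier of the extension V of class [x], acting on row vectors: a section
   of V is a row f with f(qz) M(z) = f(z). *)
Definition multiplier (eta : C) (k : nat) (x : nat -> C) (z : C) : M2 :=
  mat2 (/ (eta * z) ^ k)               0
       ((eta * z) ^ k * xpoly k x z)   ((eta * z) ^ k).

Definition multiplier_inv (eta : C) (k : nat) (x : nat -> C) (z : C) : M2 :=
  mat2 ((eta * z) ^ k)                    0
       (- ((eta * z) ^ k * xpoly k x z))  (/ (eta * z) ^ k).

(* f |-> f A preserves the sections of V iff A(qz) M(z) = M(z) A(z), i.e. iff A
   is fixed by [adq]; so [adq] is the q-shift on cochains of End(V). *)
Definition adq (q eta : C) (k : nat) (x : nat -> C) (A : C -> M2) (z : C) : M2 :=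
  mmul (mmul (multiplier_inv eta k x z) (A (q * z))) (multiplier eta k x z).

(* The coboundary A |-> M^{-1} A_q M - A, whose cokernel is H^1. *)
Definition cobound (q eta : C) (k : nat) (x : nat -> C) (A : C -> M2) (z : C) : M2 :=
  msub (adq q eta k x A z) (A z).

Definition cochain_g (A : C -> M2) : Prop :=
  (forall i j : nat, (i < 2)%nat -> (j < 2)%nat ->
     holomorphic (fun z => entry (A z) i j)) /\
  (forall z : C, z <> 0 -> mtrace (A z) = 0).

(* The flag is the subbundle of rows (f_1, 0), so the matrices preserving it
   under right multiplication are the lower triangular ones. *)
Definition cochain_p (A : C -> M2) : Prop :=
  cochain_g A /\ forall z : C, z <> 0 -> entry (A z) 0 1 = 0.

(* The class of the cochain P in H^1(E_q, p(xi)), as a set of cochains. *)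
Definition H1_p_class (q eta : C) (k : nat) (x : nat -> C)
    (P : C -> M2) (Q : C -> M2) : Prop :=
  cochain_p Q /\
  exists A : C -> M2, cochain_p A /\
    forall z : C, z <> 0 -> msub (Q z) (P z) = cobound q eta k x A z.

(* The upper right entry identifies u_-(xi) = g(xi)/p(xi) with the line bundle
   whose multiplier is (eta z)^{2k}. *)
Definition H0_uminus (q eta : C) (k : nat) (b : C -> C) : Prop :=
  holomorphic b /\
  forall z : C, z <> 0 -> (eta * z) ^ (2 * k) * b (q * z) = b z.

Definition H0_pminus (q eta : C) (k : nat) (x : nat -> C) (D : C -> M2) : Prop :=
  exists a b : C -> C,
    holomorphic a /\ holomorphic b /\
    (forall z : C, z <> 0 -> D z = mat2 (a z) (b z) 0 (- a z)) /\
    (forall z : C, z <> 0 -> (eta * z) ^ (2 * k) * b (q * z) = b z) /\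
    (forall z : C, z <> 0 -> a (q * z) - a z = - (b z * xpoly k x z)).

Definition tau (D : C -> M2) (z : C) : C := entry (D z) 0 1.

(* The connecting map H^0(u_-) -> H^1(p), with values sets of cochains: lift b
   to a cochain A of g and take the coboundary of A.  By [connecting_class] its
   value is exactly one class. *)
Definition connecting (q eta : C) (k : nat) (x : nat -> C)
    (b : C -> C) (P : C -> M2) : Prop :=
  cochain_p P /\
  exists A : C -> M2, cochain_g A /\
    (forall z : C, z <> 0 -> entry (A z) 0 1 = b z) /\
    (forall z : C, z <> 0 -> P z = cobound q eta k x A z).

Definition Bsharp (q eta : C) (k : nat) (x : nat -> C)
    (D : C -> M2) : (C -> M2) -> Prop :=
  connecting q eta k x (tau D).

(* The pairing of a class (a set of cochains) with an element of H^0(p_-) is c: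
   every representative gives the constant coefficient c. *)
Definition pairing (cl : (C -> M2) -> Prop) (D : C -> M2) (c : C) : Prop :=
  (exists P : C -> M2, cl P) /\
  forall P : C -> M2, cl P ->
    constant_coeff (fun z => mtrace (mmul (P z) (D z))) c.

Definition is_theta (q eta : C) (k m : nat) (b : C -> C) : Prop :=
  forall z : C, z <> 0 ->
    has_sum (fun _ : Z => True)
      (fun l : Z =>
         let k' := Z.of_nat k in
         let m' := Z.of_nat m in
         q ^^ (- (m' * l)) * q ^^ (k' * l * (l - 1)) *
         eta ^^ (2 * k' * l) * z ^^ (2 * k' * l - m'))
      (b z).

(* D is a cotangent vector d(theta_{-m}) at [x]; the diagonal entry of D is only
   determined up to an additive constant. *)
Definition is_dtheta (q eta : C) (k : nat) (x : nat -> C) (m : nat)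
    (D : C -> M2) : Prop :=
  H0_pminus q eta k x D /\ is_theta q eta k m (tau D).

(* Consistency checks. *)

Lemma mat2_eta (A : M2) :
  A = mat2 (entry A 0 0) (entry A 0 1) (entry A 1 0) (entry A 1 1).
Proof. destruct A as [[a [b []]] [[c [d []]] []]]. reflexivity. Qed.

Lemma mat2_ext (a b c d a' b' c' d' : C) :
  a = a' -> b = b' -> c = c' -> d = d' -> mat2 a b c d = mat2 a' b' c' d'.
Proof. now intros -> -> -> ->. Qed.

Lemma mmul_mat2 (a b c d a' b' c' d' : C) :
  mmul (mat2 a b c d) (mat2 a' b' c' d') =
  mat2 (a * a' + b * c') (a * b' + b * d') (c * a' + d * c') (c * b' + d * d').
Proof.
unfold mmul, Mmult, mat2, mk_matrix; simpl.
rewrite !sum_Sn, !sum_O. reflexivity.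
Qed.

Lemma msub_mat2 (a b c d a' b' c' d' : C) :
  msub (mat2 a b c d) (mat2 a' b' c' d') =
  mat2 (a - a') (b - b') (c - c') (d - d').
Proof. reflexivity. Qed.

Section Checks.
Variables (q eta : C) (k : nat) (x : nat -> C).
Hypotheses (hq : q <> 0) (heta : eta <> 0).

Lemma Cpow_ne (z : C) (j : nat) : z <> 0 -> z ^ j <> 0.
Proof.
intros hz; induction j as [|j IH]; simpl.
- intros h; apply (f_equal fst) in h; simpl in h; lra.
- now apply Cmult_neq_0.
Qed.

Lemma multiplier_invE (z : C) : z <> 0 ->
  mmul (multiplier_inv eta k x z) (multiplier eta k x z) = mat2 1 0 0 1.
Proof.
intros hz. unfold multiplier, multiplier_inv. rewrite mmul_mat2.
assert (h : (eta * z) ^ k <> 0) by (apply Cpow_ne, Cmult_neq_0; assumption).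
apply mat2_ext; now field.
Qed.

Lemma adq_mat2 (A : C -> M2) (a b c d : C -> C) (z : C) : z <> 0 ->
  A (q * z) = mat2 (a (q * z)) (b (q * z)) (c (q * z)) (d (q * z)) ->
  let f := (eta * z) ^ (2 * k) in
  let y := xpoly k x z in
  adq q eta k x A z =
  mat2 (a (q * z) + f * b (q * z) * y)
       (f * b (q * z))
       (/ f * c (q * z) + (d (q * z) - a (q * z)) * y - f * b (q * z) * y * y)
       (d (q * z) - f * b (q * z) * y).
Proof.
intros hz hA; simpl. unfold adq, multiplier, multiplier_inv.
rewrite hA, !mmul_mat2.
assert (h : (eta * z) ^ k <> 0) by (apply Cpow_ne, Cmult_neq_0; assumption).
replace ((eta * z) ^ (k + (k + 0))) with ((eta * z) ^ k * (eta * z) ^ k)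
  by (now rewrite <- Cpow_add_r, Nat.add_0_r).
apply mat2_ext; field; auto.
Qed.

(* [H0_pminus] is invariance under [adq] modulo the lower left entry u(xi). *)
Lemma H0_pminus_adq (a b : C -> C) :
  let D z := mat2 (a z) (b z) 0 (- a z) in
  holomorphic a -> holomorphic b ->
  (H0_pminus q eta k x D <->
   forall z : C, z <> 0 ->
     entry (adq q eta k x D z) 0 0 = entry (D z) 0 0 /\
     entry (adq q eta k x D z) 0 1 = entry (D z) 0 1 /\
     entry (adq q eta k x D z) 1 1 = entry (D z) 1 1).
Proof.
intros D ha hb.
assert (E := fun (z : C) hz => adq_mat2 D a b (fun _ => 0) (fun z => - a z) z hz eq_refl).
split.
- intros (a' & b' & _ & _ & h1 & h2 & h3) z hz.
  assert (Ha : forall z : C, z <> 0 -> a z = a' z)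
    by (intros w hw; exact (f_equal (fun M => entry M 0 0) (h1 w hw))).
  assert (Hb : forall z : C, z <> 0 -> b z = b' z)
    by (intros w hw; exact (f_equal (fun M => entry M 0 1) (h1 w hw))).
  assert (hqz : q * z <> 0) by now apply Cmult_neq_0.
  specialize (h2 z hz); specialize (h3 z hz).
  rewrite <- !Ha, <- !Hb in * by assumption.
  rewrite (E z hz). cbv beta. rewrite h2.
  assert (h3' : a (q * z) = a z - b z * xpoly k x z).
  { replace (a (q * z)) with (a (q * z) - a z + a z) by ring.
    rewrite h3. ring. }
  unfold D; change (entry (mat2 ?s ?t ?u ?v) 0 0) with s.
  change (a (q * z) + b z * xpoly k x z = a z /\ b z = b z /\
          - a (q * z) - b z * xpoly k x z = - a z).
  rewrite h3'. repeat split; ring.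
- intros h. exists a, b. repeat split; auto; intros z hz;
  destruct (h z hz) as (h1 & h2 & h3); rewrite (E z hz) in h1, h2, h3.
  + exact h2.
  + change (a (q * z) + (eta * z) ^ (2 * k) * b (q * z) * xpoly k x z = a z) in h1.
    change ((eta * z) ^ (2 * k) * b (q * z) = b z) in h2.
    rewrite h2 in h1. rewrite <- h1. ring.
Qed.

Lemma adqE (A : C -> M2) (z : C) : z <> 0 ->
  let f := (eta * z) ^ (2 * k) in
  let y := xpoly k x z in
  let e i j := entry (A (q * z)) i j in
  adq q eta k x A z =
  mat2 (e 0%nat 0%nat + f * e 0%nat 1%nat * y)
       (f * e 0%nat 1%nat)
       (/ f * e 1%nat 0%nat + (e 1%nat 1%nat - e 0%nat 0%nat) * y
        - f * e 0%nat 1%nat * y * y)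
       (e 1%nat 1%nat - f * e 0%nat 1%nat * y).
Proof.
intros hz.
exact (adq_mat2 A (fun w => entry (A w) 0 0) (fun w => entry (A w) 0 1)
  (fun w => entry (A w) 1 0) (fun w => entry (A w) 1 1) z hz (mat2_eta _)).
Qed.

Lemma cobound_comb (A B D : C -> M2) (s : C) :
  (forall z i j, (i < 2)%nat -> (j < 2)%nat ->
     entry (D z) i j = entry (A z) i j + s * entry (B z) i j) ->
  forall (z : C) i j, z <> 0 -> (i < 2)%nat -> (j < 2)%nat ->
    entry (cobound q eta k x D z) i j =
    entry (cobound q eta k x A z) i j + s * entry (cobound q eta k x B z) i j.
Proof.
intros h z i j hz hi hj. unfold cobound.
rewrite !adqE by assumption.
rewrite (mat2_eta (D z)), (mat2_eta (A z)), (mat2_eta (B z)), !msub_mat2.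
rewrite !h by lia.
destruct i as [|[|i]]; [| |lia]; (destruct j as [|[|j]]; [| |lia]);
  unfold entry, coeff_mat, mat2; simpl; ring.
Qed.

Lemma entry_ext (A B : M2) :
  (forall i j, (i < 2)%nat -> (j < 2)%nat -> entry A i j = entry B i j) -> A = B.
Proof.
intros h. rewrite (mat2_eta A), (mat2_eta B). apply mat2_ext; apply h; lia.
Qed.

Lemma holomorphic_plus (f g : C -> C) :
  holomorphic f -> holomorphic g -> holomorphic (fun z => f z + g z).
Proof. intros hf hg z hz; apply (ex_derive_plus (K := C_AbsRing) (V := C_NormedModule)); auto. Qed.

Lemma is_derive_C (f : C -> C) (z l : C) :
  is_derive (K := C_AbsRing) (V := C_NormedModule) f z l <->
  is_derive (K := C_AbsRing) (V := AbsRing_NormedModule C_AbsRing) f z l.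
Proof.
split; intros [[h1 h2 h3] h4]; split;
  [split; assumption | exact h4 | split; assumption | exact h4].
Qed.

Lemma holomorphic_mult (f g : C -> C) :
  holomorphic f -> holomorphic g -> holomorphic (fun z => f z * g z).
Proof.
intros hf hg z hz. destruct (hf z hz) as [df Hf]; destruct (hg z hz) as [dg Hg].
apply is_derive_C in Hf; apply is_derive_C in Hg.
exists (df * g z + f z * dg); apply is_derive_C.
apply (is_derive_mult (K := C_AbsRing) f g z df dg Hf Hg).
intros; apply Cmult_comm.
Qed.

Lemma holomorphic_cst (c : C) : holomorphic (fun _ => c).
Proof. intros z _; apply (ex_derive_const (K := C_AbsRing) (V := C_NormedModule)). Qed.

Lemma holomorphic_opp (f : C -> C) :
  holomorphic f -> holomorphic (fun z => - f z).
Proof. intros hf z hz; apply (ex_derive_opp (K := C_AbsRing) (V := C_NormedModule)); auto. Qed.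

Lemma holomorphic_pow (j : nat) : holomorphic (fun z => z ^ j).
Proof.
induction j as [|j IH]; simpl; [apply holomorphic_cst|].
apply holomorphic_mult; [|assumption].
intros z _; exists (RtoC 1); apply is_derive_C.
apply (is_derive_id (K := C_AbsRing)).
Qed.

Lemma holomorphic_xpoly : holomorphic (xpoly k x).
Proof.
unfold xpoly, lsum. induction (seq 0 (2 * k)) as [|j l IH]; simpl.
- apply holomorphic_cst.
- apply holomorphic_plus; [|exact IH].
  apply holomorphic_mult; [apply holomorphic_cst|apply holomorphic_pow].
Qed.

Lemma cochain_g_comb (A B : C -> M2) (s : C) :
  cochain_g A -> cochain_g B ->
  cochain_g (fun z => mat2
    (entry (A z) 0 0 + s * entry (B z) 0 0) (entry (A z) 0 1 + s * entry (B z) 0 1)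
    (entry (A z) 1 0 + s * entry (B z) 1 0) (entry (A z) 1 1 + s * entry (B z) 1 1)).
Proof.
intros [hA tA] [hB tB]; split.
- intros i j hi hj.
  assert (h := holomorphic_plus _ _ (hA i j hi hj)
    (holomorphic_mult _ _ (holomorphic_cst s) (hB i j hi hj))).
  destruct i as [|[|i]]; [| |lia]; (destruct j as [|[|j]]; [| |lia]); exact h.
- intros z hz; specialize (tA z hz); specialize (tB z hz); unfold mtrace in *.
  change (entry (A z) 0 0 + s * entry (B z) 0 0 +
          (entry (A z) 1 1 + s * entry (B z) 1 1) = 0).
  replace (RtoC 0) with ((entry (A z) 0 0 + entry (A z) 1 1) +
    s * (entry (B z) 0 0 + entry (B z) 1 1)); [ring|].
  rewrite tA, tB; ring.
Qed.

Lemma connecting_class (b : C -> C) :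
  H0_uminus q eta k b ->
  exists P : C -> M2, cochain_p P /\
    forall Q : C -> M2,
      connecting q eta k x b Q <-> H1_p_class q eta k x P Q.
Proof.
intros [hb hb'].
pose (A0 := fun z => mat2 0 (b z) 0 0).
pose (P := fun z => mat2 (b z * xpoly k x z) 0
  (- (b z * xpoly k x z * xpoly k x z)) (- (b z * xpoly k x z))).
assert (EP : forall z : C, z <> 0 -> P z = cobound q eta k x A0 z).
{ intros z hz. unfold cobound.
  rewrite (adq_mat2 A0 (fun _ => 0) b (fun _ => 0) (fun _ => 0) z hz eq_refl).
  unfold A0; rewrite msub_mat2; cbv beta; rewrite (hb' z hz).
  apply mat2_ext; ring. }
assert (gA0 : cochain_g A0).
{ split.
  - intros i j hi hj.
    destruct i as [|[|i]]; [| |lia]; (destruct j as [|[|j]]; [| |lia]);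
      first [exact hb | exact (holomorphic_cst 0)].
  - intros z _; change (RtoC 0 + 0 = 0); ring. }
assert (hy := holomorphic_xpoly).
assert (hby := holomorphic_mult _ _ hb hy).
assert (gP : cochain_p P).
{ split; [split|].
  - intros i j hi hj.
    destruct i as [|[|i]]; [| |lia]; (destruct j as [|[|j]]; [| |lia]).
    + exact hby.
    + exact (holomorphic_cst 0).
    + exact (holomorphic_opp _ (holomorphic_mult _ _ hby hy)).
    + exact (holomorphic_opp _ hby).
  - intros z _; change (b z * xpoly k x z + - (b z * xpoly k x z) = 0); ring.
  - intros z _; reflexivity. }
exists P; split; [exact gP|]; intros Q; split.
- intros [hQ [A [gA [eA EQ]]]]; split; [exact hQ|].
  pose (D := fun z => mat2
    (entry (A z) 0 0 + - (1) * entry (A0 z) 0 0)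
    (entry (A z) 0 1 + - (1) * entry (A0 z) 0 1)
    (entry (A z) 1 0 + - (1) * entry (A0 z) 1 0)
    (entry (A z) 1 1 + - (1) * entry (A0 z) 1 1)).
  exists D; split; [split|].
  + apply cochain_g_comb; assumption.
  + intros z hz. change (entry (A z) 0 1 + - (1) * b z = 0).
    rewrite (eA z hz); ring.
  + intros z hz. apply entry_ext; intros i j hi hj.
    rewrite (cobound_comb A A0 D (- (1))), <- EP, <- EQ by
      solve [assumption | intros w i' j' hi' hj';
       destruct i' as [|[|i']]; [| |lia]; (destruct j' as [|[|j']]; [| |lia]);
       reflexivity].
    rewrite (mat2_eta (Q z)), (mat2_eta (P z)), msub_mat2.
    destruct i as [|[|i]]; [| |lia]; (destruct j as [|[|j]]; [| |lia]);
      unfold entry, coeff_mat, mat2; simpl; ring.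
- intros [hQ [A [[gA eA] EQ]]]; split; [exact hQ|].
  pose (D := fun z => mat2
    (entry (A z) 0 0 + 1 * entry (A0 z) 0 0)
    (entry (A z) 0 1 + 1 * entry (A0 z) 0 1)
    (entry (A z) 1 0 + 1 * entry (A0 z) 1 0)
    (entry (A z) 1 1 + 1 * entry (A0 z) 1 1)).
  exists D; split; [|split].
  + apply cochain_g_comb; assumption.
  + intros z hz. change (entry (A z) 0 1 + 1 * b z = b z).
    rewrite (eA z hz); ring.
  + intros z hz. apply entry_ext; intros i j hi hj.
    rewrite (cobound_comb A A0 D 1), <- EP, <- EQ by
      solve [assumption | intros w i' j' hi' hj';
       destruct i' as [|[|i']]; [| |lia]; (destruct j' as [|[|j']]; [| |lia]);
       reflexivity].
    rewrite (mat2_eta (Q z)), (mat2_eta (P z)), msub_mat2.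
    destruct i as [|[|i]]; [| |lia]; (destruct j as [|[|j]]; [| |lia]);
      unfold entry, coeff_mat, mat2; simpl; ring.
Qed.

End Checks.

(* Main.v *)
(* For a representative P of the image of d(theta_{-m}), expanding tr(P D_n)
   gives two q-differences, whose constant coefficients vanish, plus
   b_m x (a_n + a_n(q .)).  The relation a_n(qz) - a_n(z) = - b_n(z) x(z)
   determines the nonzero Laurent coefficients of a_n, which produces the factor
   (q^u + 1) / (q^u - 1); the coefficient u = 0 of b_m x is x_m = 0.

   The cochains are arbitrary holomorphic functions on C^*, so Laurent's theorem
   is needed for functions that are merely complex differentiable.  Goursat's
   theorem in the coordinate log z shows that circle means do not depend on the
   radius, hence the Fourier coefficients on the circle |w| = |z| are a_n z^n
   with a_n independent of z, and decay geometrically.  Their sum is F(z) by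
   Chernoff's argument: if F(zw) = F(z) + (w - 1) g(w) with g continuous on
   |w| = 1, the coefficients telescope and the partial sums converge by the
   Riemann-Lebesgue lemma. *)

From Stdlib Require Import Permutation Classical.
Require Import Defs.

(** * Integrals of complex-valued functions *)

(** The target is an unconditional sum over triples (u, l, t), while the bracket is one circle mean,
    that of [phi * psi] with phi = b_m x and psi = a_n + a_n(q .). Only phi is expanded: its Laurent
    series, integrated term by term against the function psi, gives a series over u alone. The
    triple sum is this series in disguise. Since x_j vanishes outside 0 <= j < 2k, Euclidean
    division of m + u and of n - u by 2k leaves a single pair (l, t) with a possibly nonzero term
    for each u. Coefficients are handled as integrals over the unit circle, which makes them linear
    and computable from any convergent expansion. Termwise integration is cheap there: |z^j| = 1, so
    absolute convergence at one point of the circle is uniform convergence on the whole circle. Two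
    choices have to drop out. The lift of b_m to a cochain of g enters the trace only through
    q-differences. An additive constant in a_n changes only the constant coefficient of psi, which
    is multiplied by that of phi, namely x_m = 0. The condition |q| < 1 ensures q^u <> 1 for u <>
    0. *)

Definition Ccont (f : R -> C) (t : R) : Prop :=
  continuous (T := R_UniformSpace) (U := C_UniformSpace) f t.

(** The undivided form of differentiability: it allows w = z and is the estimate that Goursat's
    argument consumes. *)
Definition Cder (f : C -> C) (z l : C) : Prop :=
  forall eps : R, (0 < eps)%R -> exists d : R, (0 < d)%R /\
    forall w : C, (Cmod (w - z) < d)%R ->
      (Cmod (f w - f z - l * (w - z)) <= eps * Cmod (w - z))%R.

Lemma Cder_is_derive (f : C -> C) (z l : C) :
  Cder f z l <-> is_derive (K := C_AbsRing) (V := C_NormedModule) f z l.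
Proof.
split.
- intros h. split.
  + apply (is_linear_scal_l (K := C_AbsRing) (V := C_NormedModule)).
  + intros z' hz'.
    apply (is_filter_lim_locally_unique (K := C_AbsRing) (V := AbsRing_NormedModule C_AbsRing)) in hz'.
    subst z'. intros eps. destruct (h eps (cond_pos eps)) as (d & hd & H).
    exists (mkposreal d hd). intros w hw.
    change (Cmod (f w + - f z + - ((w + - z) * l)) <= eps * Cmod (w + - z))%R.
    change (Cmod (w + - z) < d)%R in hw.
    specialize (H w hw). unfold Cminus in H.
    rewrite (Cmult_comm l) in H. exact H.
- intros [_ h] eps heps.
  destruct (h z (fun P hP => hP) (mkposreal eps heps)) as [d H].
  exists d; split; [apply cond_pos|]. intros w hw.
  specialize (H w hw).
  change (Cmod (f w + - f z + - ((w + - z) * l)) <= eps * Cmod (w + - z))%R in H.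
  unfold Cminus. rewrite (Cmult_comm l). exact H.
Qed.

Lemma Ccont_eps (f : R -> C) (t : R) :
  Ccont f t <-> forall eps : R, (0 < eps)%R -> exists d : R, (0 < d)%R /\
    forall s : R, (Rabs (s - t) < d)%R -> (Cmod (f s - f t) < eps)%R.
Proof.
split.
- intros h eps heps.
  (* Balls of [C_UniformSpace] are coordinatewise, so passing to [Cmod] costs a factor sqrt 2 <
     2. *)
  assert (he : (0 < eps / 2)%R) by lra.
  destruct (proj1 (filterlim_locally (U := C_UniformSpace) f (f t)) h (mkposreal _ he)) as [d H].
  exists d; split; [apply cond_pos|]. intros s hs.
  specialize (H s hs).
  apply (C_NormedModule_mixin_compat2 _ _ (mkposreal _ he)) in H. simpl in H.
  change (Cmod (f s - f t) < sqrt 2 * (eps / 2))%R in H.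
  assert (sqrt 2 < 2)%R.
  { rewrite <- (sqrt_Rsqr 2) at 2 by lra. apply sqrt_lt_1; unfold Rsqr; lra. }
  nra.
- intros h. apply (filterlim_locally (U := C_UniformSpace)). intros eps.
  destruct (h eps (cond_pos eps)) as (d & hd & H).
  exists (mkposreal d hd). intros s hs. apply C_NormedModule_mixin_compat1.
  apply H, hs.
Qed.

Definition CRInt (f : R -> C) (a b : R) : C := RInt (V := C_R_CompleteNormedModule) f a b.

Lemma CRInt_ex (f : R -> C) (a b : R) :
  (forall t, Ccont f t) -> ex_RInt (V := C_R_CompleteNormedModule) f a b.
Proof. intros h; apply ex_RInt_continuous; intros; apply h. Qed.

Lemma CRInt_correct (f : R -> C) (a b : R) :
  (forall t, Ccont f t) -> is_RInt (V := C_R_NormedModule) f a b (CRInt f a b).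
Proof. intros h. apply (RInt_correct (V := C_R_CompleteNormedModule)), CRInt_ex, h. Qed.

Lemma CRInt_unique (f : R -> C) (a b : R) (l : C) :
  is_RInt (V := C_R_NormedModule) f a b l -> CRInt f a b = l.
Proof. apply (is_RInt_unique (V := C_R_CompleteNormedModule)). Qed.

Lemma CRInt_ext (f g : R -> C) (a b : R) : (forall t, f t = g t) -> CRInt f a b = CRInt g a b.
Proof. intros h; apply (RInt_ext (V := C_R_CompleteNormedModule)); intros; apply h. Qed.

Lemma CRInt_plus (f g : R -> C) (a b : R) :
  (forall t, Ccont f t) -> (forall t, Ccont g t) ->
  CRInt (fun t => f t + g t) a b = CRInt f a b + CRInt g a b.
Proof.
intros hf hg; apply CRInt_unique.
apply (is_RInt_plus (V := C_R_NormedModule)); now apply CRInt_correct.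
Qed.

(** The integral lives in a module over the reals, and a complex factor mixes the two coordinates,
    so each coordinate is integrated separately. *)
Lemma is_RInt_scal_C (f : R -> C) (a b : R) (c l : C) :
  is_RInt (V := C_R_NormedModule) f a b l ->
  is_RInt (V := C_R_NormedModule) (fun t => c * f t) a b (c * l).
Proof.
intros h.
assert (h1 := is_RInt_fct_extend_fst (U := R_NormedModule) (V := R_NormedModule) f a b l h).
assert (h2 := is_RInt_fct_extend_snd (U := R_NormedModule) (V := R_NormedModule) f a b l h).
apply (is_RInt_fct_extend_pair (U := R_NormedModule) (V := R_NormedModule)).
- apply (is_RInt_minus (V := R_NormedModule)); apply (is_RInt_scal (V := R_NormedModule)); assumption.
- apply (is_RInt_plus (V := R_NormedModule)); apply (is_RInt_scal (V := R_NormedModule)); assumption.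
Qed.

Lemma CRInt_scal (f : R -> C) (a b : R) (c : C) :
  (forall t, Ccont f t) -> CRInt (fun t => c * f t) a b = c * CRInt f a b.
Proof. intros hf; apply CRInt_unique, is_RInt_scal_C, CRInt_correct, hf. Qed.

Lemma CRInt_Chasles (f : R -> C) (a b c : R) :
  (forall t, Ccont f t) -> CRInt f a c = CRInt f a b + CRInt f b c.
Proof.
intros hf. symmetry.
apply (RInt_Chasles (V := C_R_CompleteNormedModule)); now apply CRInt_ex.
Qed.

Lemma CRInt_const (a b : R) (c : C) : CRInt (fun _ => c) a b = (b - a)%R * c.
Proof.
unfold CRInt. rewrite (RInt_const (V := C_R_CompleteNormedModule)).
change (scal ?u ?v) with (prod_scal (K := R_AbsRing) (U := R_NormedModule) (V := R_NormedModule) u v).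
unfold prod_scal, scal; simpl. unfold mult; simpl. unfold Cmult; simpl.
apply injective_projections; simpl; ring.
Qed.

Lemma CRInt_bound (f : R -> C) (a b M : R) :
  (a <= b)%R -> (forall t, Ccont f t) ->
  (forall t, (a <= t <= b)%R -> (Cmod (f t) <= M)%R) ->
  (Cmod (CRInt f a b) <= (b - a) * M)%R.
Proof.
intros hab hf hM. rewrite Cmod_norm.
apply (norm_RInt_le_const (V := C_R_NormedModule) f a b); auto.
- intros t ht; rewrite <- Cmod_norm; auto.
- now apply CRInt_correct.
Qed.

Lemma CRInt_shift (f : R -> C) (a b h : R) :
  (forall t, Ccont f t) -> CRInt (fun t => f (t + h)%R) a b = CRInt f (a + h) (b + h).
Proof.
intros hf. apply CRInt_unique.
assert (H := is_RInt_comp_lin (V := C_R_NormedModule) f 1 h a b (CRInt f (a + h) (b + h))).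
apply (is_RInt_ext (V := C_R_NormedModule)) with (2 := H ltac:(rewrite !Rmult_1_l; now apply CRInt_correct)).
intros t _. rewrite Rmult_1_l. apply (scal_one (K := R_AbsRing) (V := C_R_NormedModule)).
Qed.

Lemma Ccont_ext (f g : R -> C) (t : R) : (forall s, f s = g s) -> Ccont f t -> Ccont g t.
Proof. intros h; apply (continuous_ext (U := C_UniformSpace)); exact h. Qed.

Lemma Ccont_const (c : C) (t : R) : Ccont (fun _ : R => c) t.
Proof. apply (continuous_const (U := R_UniformSpace) (V := C_UniformSpace)). Qed.

Lemma Ccont_plus (f g : R -> C) (t : R) :
  Ccont f t -> Ccont g t -> Ccont (fun s => f s + g s) t.
Proof. apply (continuous_plus (V := C_R_NormedModule)). Qed.

Lemma Ccont_mult (f g : R -> C) (t : R) :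
  Ccont f t -> Ccont g t -> Ccont (fun s => f s * g s) t.
Proof.
rewrite !Ccont_eps. intros hf hg eps heps.
assert (p1 := Cmod_ge_0 (f t)). assert (p2 := Cmod_ge_0 (g t)).
pose (m := (1 + Cmod (f t) + Cmod (g t))%R).
assert (hm : (0 < m)%R) by (unfold m; lra).
(* With [eta <= 1] the product of the two errors is at most [eta], so the total error stays below
   [eta * m <= eps]. *)
pose (eta := Rmin 1 (eps / m)).
assert (he : (0 < eta)%R) by (apply Rmin_pos; [lra|apply Rdiv_lt_0_compat; lra]).
assert (he1 : (eta <= 1)%R) by apply Rmin_l.
assert (he2 : (eta * m <= eps)%R).
{ apply Rle_trans with (eps / m * m)%R.
  - apply Rmult_le_compat_r; [lra|apply Rmin_r].
  - right; field; lra. }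
destruct (hf eta he) as (d1 & hd1 & H1), (hg eta he) as (d2 & hd2 & H2).
exists (Rmin d1 d2); split; [now apply Rmin_pos|]. intros s hs.
specialize (H1 s (Rlt_le_trans _ _ _ hs (Rmin_l _ _))).
specialize (H2 s (Rlt_le_trans _ _ _ hs (Rmin_r _ _))).
replace (f s * g s - f t * g t) with
  ((f s - f t) * (g s - g t) + f t * (g s - g t) + (f s - f t) * g t) by ring.
assert (q1 := Cmod_ge_0 (f s - f t)). assert (q2 := Cmod_ge_0 (g s - g t)).
eapply Rle_lt_trans; [apply Cmod_triangle|].
eapply Rle_lt_trans; [apply Rplus_le_compat_r, Cmod_triangle|].
rewrite !Cmod_mult. unfold m in he2. nra.
Qed.

(** * Goursat's theorem for rectangles *)

Lemma nested_intervals (a b : nat -> R) :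
  (forall n, (a n <= a (S n))%R) -> (forall n, (b (S n) <= b n)%R) ->
  (forall n, (a n <= b n)%R) ->
  exists p : R, forall n, (a n <= p <= b n)%R.
Proof.
intros ha hb hab.
assert (ha' : forall n m, (a n <= a (n + m)%nat)%R).
{ intros n m; induction m as [|m IH]; [rewrite Nat.add_0_r; lra|].
  rewrite Nat.add_succ_r. specialize (ha (n + m)%nat). lra. }
assert (hb' : forall n m, (b (n + m)%nat <= b n)%R).
{ intros n m; induction m as [|m IH]; [rewrite Nat.add_0_r; lra|].
  rewrite Nat.add_succ_r. specialize (hb (n + m)%nat). lra. }
assert (H : forall n m, (a n <= b m)%R).
{ intros n m. apply Rle_trans with (a (n + m)%nat); [apply ha'|].
  apply Rle_trans with (b (n + m)%nat); [apply hab|].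
  rewrite Nat.add_comm; apply hb'. }
destruct (completeness (fun r => exists n, r = a n)) as [p [hp1 hp2]].
- exists (b 0%nat). intros r [n ->]; apply H.
- exists (a 0%nat), 0%nat; reflexivity.
- exists p; intros n; split.
  + apply hp1; exists n; reflexivity.
  + apply hp2. intros r [m ->]; apply H.
Qed.

(** Goursat's subdivision for any function of rectangles that is additive under both kinds of cuts.
    Halving both sides divides the square of (width + height) by 4, so if the bound fails on a
    rectangle it fails on one of its quarters. The nested quarters shrink to a point (p1, p2), where
    the local bound is contradicted. *)
Lemma rectangle_bisection (Phi : R -> R -> R -> R -> C) (a b c d eta : R) :
  (a <= b)%R -> (c <= d)%R -> (0 < eta)%R ->
  (forall a b c d e, Phi a b c d = Phi a e c d + Phi e b c d) ->
  (forall a b c d e, Phi a b c d = Phi a b c e + Phi a b e d) ->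
  (forall p1 p2 : R, exists r : R, (0 < r)%R /\
     forall a b c d, (a <= p1 <= b)%R -> (c <= p2 <= d)%R ->
       ((b - a) + (d - c) < r)%R ->
       (Cmod (Phi a b c d) <= eta * ((b - a) + (d - c)) ^ 2)%R) ->
  (Cmod (Phi a b c d) <= eta * ((b - a) + (d - c)) ^ 2)%R.
Proof.
intros hab hcd heta hx hy hloc.
destruct (Rle_lt_dec (Cmod (Phi a b c d)) (eta * ((b - a) + (d - c)) ^ 2)) as [h|hbad];
  [exact h|exfalso].
pose (bad := fun '(a, b, c, d) =>
  (eta * ((b - a) + (d - c)) ^ 2 < Cmod (Phi a b c d))%R).
(* The hypotheses stand inside the specification so that [step] is total and can be iterated by
   [nat_rect]. When no quarter is bad it returns the rectangle itself, which then cannot be bad. *)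
assert (step : forall s : R * R * R * R, { s' : R * R * R * R |
  let '(a, b, c, d) := s in let '(a', b', c', d') := s' in
  (a <= b)%R -> (c <= d)%R -> bad s ->
  (a <= a' /\ b' <= b /\ b' - a' = (b - a) / 2 /\
   c <= c' /\ d' <= d /\ d' - c' = (d - c) / 2)%R /\ bad s' }).
{ intros [[[a1 b1] c1] d1].
  pose (e := ((a1 + b1) / 2)%R). pose (f := ((c1 + d1) / 2)%R).
  pose (T := (eta * (((b1 - a1) + (d1 - c1)) / 2) ^ 2)%R).
  assert (key : forall a' b' c' d', (b' - a' = (b1 - a1) / 2)%R -> (d' - c' = (d1 - c1) / 2)%R ->
     (T < Cmod (Phi a' b' c' d'))%R -> bad (a', b', c', d')).
  { intros a' b' c' d' h1 h2 h3. simpl. unfold T in h3.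
    replace (b' - a' + (d' - c'))%R with ((b1 - a1 + (d1 - c1)) / 2)%R by lra. exact h3. }
  destruct (Rlt_dec T (Cmod (Phi a1 e c1 f))) as [h1|h1];
    [exists (a1, e, c1, f); intros; split; [unfold e, f; lra|apply key; [unfold e; lra|unfold f; lra|assumption]]|].
  destruct (Rlt_dec T (Cmod (Phi e b1 c1 f))) as [h2|h2];
    [exists (e, b1, c1, f); intros; split; [unfold e, f; lra|apply key; [unfold e; lra|unfold f; lra|assumption]]|].
  destruct (Rlt_dec T (Cmod (Phi a1 e f d1))) as [h3|h3];
    [exists (a1, e, f, d1); intros; split; [unfold e, f; lra|apply key; [unfold e; lra|unfold f; lra|assumption]]|].
  destruct (Rlt_dec T (Cmod (Phi e b1 f d1))) as [h4|h4];
    [exists (e, b1, f, d1); intros; split; [unfold e, f; lra|apply key; [unfold e; lra|unfold f; lra|assumption]]|].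
  exists (a1, b1, c1, d1). intros _ _ hb. exfalso. simpl in hb.
  rewrite (hx a1 b1 c1 d1 e), (hy a1 e c1 d1 f), (hy e b1 c1 d1 f) in hb.
  assert (t1 := Cmod_triangle (Phi a1 e c1 f + Phi a1 e f d1) (Phi e b1 c1 f + Phi e b1 f d1)).
  assert (t2 := Cmod_triangle (Phi a1 e c1 f) (Phi a1 e f d1)).
  assert (t3 := Cmod_triangle (Phi e b1 c1 f) (Phi e b1 f d1)).
  replace (eta * ((b1 - a1 + (d1 - c1)) * ((b1 - a1 + (d1 - c1)) * 1)))%R with (4 * T)%R in hb
    by (unfold T; field).
  lra. }
pose (s := nat_rect (fun _ => (R * R * R * R)%type) (a, b, c, d)
             (fun _ s => proj1_sig (step s))).
pose (sa := fun n => fst (fst (fst (s n)))). pose (sb := fun n => snd (fst (fst (s n)))).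
pose (sc := fun n => snd (fst (s n))). pose (sd := fun n => snd (s n)).
assert (es : forall n, s n = (sa n, sb n, sc n, sd n)).
{ intros n. unfold sa, sb, sc, sd. destruct (s n) as [[[? ?] ?] ?]; reflexivity. }
assert (inv0 : forall n, (sa n <= sb n)%R /\ (sc n <= sd n)%R /\ bad (s n)).
{ induction n as [|n (h1 & h2 & h3)].
  - unfold sa, sb, sc, sd; simpl; auto.
  - assert (S1 := proj2_sig (step (s n))). change (proj1_sig (step (s n))) with (s (S n)) in S1.
    rewrite (es n), (es (S n)) in S1. rewrite <- (es n), <- (es (S n)) in S1.
    specialize (S1 h1 h2 h3). destruct S1 as [S1 S2].
    split; [lra|]. split; [lra|exact S2]. }
assert (inv : forall n, (sa n <= sa (S n) /\ sb (S n) <= sb n /\ sb (S n) - sa (S n) = (sb n - sa n) / 2 /\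
   sc n <= sc (S n) /\ sd (S n) <= sd n /\ sd (S n) - sc (S n) = (sd n - sc n) / 2)%R).
{ intros n. destruct (inv0 n) as (h1 & h2 & h3).
  assert (S1 := proj2_sig (step (s n))). change (proj1_sig (step (s n))) with (s (S n)) in S1.
  rewrite (es n), (es (S n)) in S1. rewrite <- (es n), <- (es (S n)) in S1.
  exact (proj1 (S1 h1 h2 h3)). }
destruct (nested_intervals sa sb) as [p1 hp1];
  [intros n; apply inv|intros n; apply inv|intros n; apply inv0|].
destruct (nested_intervals sc sd) as [p2 hp2];
  [intros n; apply inv|intros n; apply inv|intros n; apply inv0|].
destruct (hloc p1 p2) as (r & hr & Hr).
pose (L := (b - a + (d - c))%R).
assert (size : forall n, ((sb n - sa n) + (sd n - sc n) = L * (/ 2) ^ n)%R).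
{ induction n as [|n IH].
  - unfold sa, sb, sc, sd, L; simpl; ring.
  - destruct (inv n) as (_ & _ & h1 & _ & _ & h2). rewrite h1, h2. simpl.
    replace (L * (/ 2 * (/ 2) ^ n))%R with (L * (/ 2) ^ n / 2)%R by field.
    rewrite <- IH. field. }
assert (hL : (0 <= L)%R) by (unfold L; lra).
(* The denominator is [L + 1] because [L] is 0 for a degenerate rectangle. *)
destruct (pow_lt_1_zero (/ 2)) with (y := (r / (L + 1))%R) as [N HN].
{ rewrite Rabs_pos_eq; lra. }
{ apply Rdiv_lt_0_compat; lra. }
specialize (HN N (Nat.le_refl N)).
assert (hpos : (0 < (/ 2) ^ N)%R) by (apply pow_lt; lra).
rewrite Rabs_pos_eq in HN by lra.
destruct (inv0 N) as (h1 & h2 & h3). rewrite (es N) in h3. unfold bad in h3.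
specialize (Hr (sa N) (sb N) (sc N) (sd N) (hp1 N) (hp2 N)).
assert (hs : (sb N - sa N + (sd N - sc N) < r)%R).
{ rewrite size. apply Rmult_lt_compat_r with (r := (L + 1)%R) in HN; [|lra].
  unfold Rdiv in HN. rewrite Rmult_assoc, Rinv_l, Rmult_1_r in HN by lra. nra. }
specialize (Hr hs). lra.
Qed.

Definition entire (H : C -> C) : Prop := forall z, exists l, Cder H z l.

(** The contour integral of H(w) dw along the counterclockwise boundary of [a, b] x [c, d]. *)
Definition rect (H : C -> C) (a b c d : R) : C :=
  CRInt (fun t => H (t, c)) a b - CRInt (fun t => H (t, d)) a b +
  Ci * (CRInt (fun t => H (b, t)) c d - CRInt (fun t => H (a, t)) c d).

Lemma Cder_cont (H : C -> C) (z l : C) : Cder H z l ->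
  forall eps, (0 < eps)%R -> exists d, (0 < d)%R /\
    forall w, (Cmod (w - z) < d)%R -> (Cmod (H w - H z) < eps)%R.
Proof.
intros h eps heps. destruct (h 1%R Rlt_0_1) as (d & hd & Hd).
assert (hm := Cmod_ge_0 l).
exists (Rmin d (eps / (Cmod l + 2))). split.
- apply Rmin_pos; [exact hd|]. apply Rdiv_lt_0_compat; lra.
- intros w hw.
  assert (h1 : (Cmod (w - z) < d)%R) by (eapply Rlt_le_trans; [exact hw|apply Rmin_l]).
  assert (h2 : (Cmod (w - z) < eps / (Cmod l + 2))%R) by (eapply Rlt_le_trans; [exact hw|apply Rmin_r]).
  specialize (Hd w h1).
  replace (H w - H z) with ((H w - H z - l * (w - z)) + l * (w - z)) by ring.
  eapply Rle_lt_trans; [apply Cmod_triangle|]. rewrite Cmod_mult.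
  apply Rmult_lt_compat_r with (r := (Cmod l + 2)%R) in h2; [|lra].
  unfold Rdiv in h2. rewrite Rmult_assoc, Rinv_l, Rmult_1_r in h2 by lra.
  assert (h3 := Cmod_ge_0 (w - z)). nra.
Qed.

Lemma entire_horizontal (H : C -> C) (y : R) : entire H -> forall t : R, Ccont (fun t => H (t, y)) t.
Proof.
intros h t. apply Ccont_eps. intros eps heps. destruct (h (t, y)) as [l hl].
destruct (Cder_cont H _ l hl eps heps) as (d & hd & Hd).
exists d; split; [exact hd|]. intros s hs. apply Hd.
replace ((s, y) - (t, y)) with (RtoC (s - t)); [now rewrite Cmod_R|].
apply injective_projections; simpl; ring.
Qed.

Lemma entire_vertical (H : C -> C) (x : R) : entire H -> forall t : R, Ccont (fun t => H (x, t)) t.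
Proof.
intros h t. apply Ccont_eps. intros eps heps. destruct (h (x, t)) as [l hl].
destruct (Cder_cont H _ l hl eps heps) as (d & hd & Hd).
exists d; split; [exact hd|]. intros s hs. apply Hd.
replace ((x, s) - (x, t)) with (Ci * RtoC (s - t)); [now rewrite Cmod_mult, Cmod_R, Cmod_Ci, Rmult_1_l|].
apply injective_projections; simpl; ring.
Qed.

Lemma CRInt_id (a b : R) : CRInt RtoC a b = ((b ^ 2 - a ^ 2) / 2)%R.
Proof.
apply CRInt_unique.
apply (is_RInt_fct_extend_pair (U := R_NormedModule) (V := R_NormedModule)).
- replace ((b ^ 2 - a ^ 2) / 2)%R with (minus (b ^ 2 / 2) (a ^ 2 / 2))%R
    by (unfold minus, plus, opp; simpl; field).
  apply (is_RInt_derive (V := R_CompleteNormedModule) (fun t => t ^ 2 / 2)%R (fun t => fst (RtoC t))).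
  + intros t _. simpl. auto_derive; auto. field.
  + intros t _. simpl. apply continuous_id.
- replace 0%R with (scal (b - a)%R (zero : R)) by (unfold scal, zero; simpl; unfold mult; simpl; ring).
  exact (is_RInt_const (V := R_NormedModule) a b 0%R).
Qed.

Lemma Ccont_RtoC (t : R) : Ccont RtoC t.
Proof.
apply Ccont_eps. intros eps h; exists eps; split; [exact h|]. intros s hs.
rewrite <- RtoC_minus, Cmod_R; exact hs.
Qed.

Lemma entire_affine (A l : C) : entire (fun w => A + l * w).
Proof.
intros z; exists l. intros eps heps; exists 1%R; split; [lra|]. intros w _.
replace (A + l * w - (A + l * z) - l * (w - z)) with (RtoC 0) by ring.
rewrite Cmod_0. assert (h := Cmod_ge_0 (w - z)). nra.
Qed.

Lemma entire_plus (F G : C -> C) : entire F -> entire G -> entire (fun w => F w + G w).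
Proof.
intros hF hG z. destruct (hF z) as [l hl], (hG z) as [l' hl']. exists (l + l').
apply Cder_is_derive. apply Cder_is_derive in hl, hl'.
apply (is_derive_plus (K := C_AbsRing) (V := C_NormedModule)); assumption.
Qed.

Lemma rect_plus (F G : C -> C) (a b c d : R) : entire F -> entire G ->
  rect (fun w => F w + G w) a b c d = rect F a b c d + rect G a b c d.
Proof.
intros hF hG. unfold rect.
rewrite !(CRInt_plus (fun t => F (t, _)) (fun t => G (t, _)))
  by (intros; apply entire_horizontal; assumption).
rewrite !(CRInt_plus (fun t => F (_, t)) (fun t => G (_, t)))
  by (intros; apply entire_vertical; assumption).
ring.
Qed.

Lemma rect_affine (A l : C) (a b c d : R) : rect (fun w => A + l * w) a b c d = 0.
Proof.
assert (h : forall (u v : R), CRInt (fun t => A + l * (t, u)) a b =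
   (b - a)%R * (A + l * (Ci * u)) + l * ((b ^ 2 - a ^ 2) / 2)%R).
{ intros u _. rewrite <- CRInt_const, <- CRInt_id, <- CRInt_scal by apply Ccont_RtoC.
  rewrite <- CRInt_plus.
  - apply CRInt_ext. intros t. apply injective_projections; simpl; ring.
  - apply Ccont_const.
  - intros t; apply Ccont_mult; [apply Ccont_const|apply Ccont_RtoC]. }
assert (v : forall (u v : R), CRInt (fun t => A + l * (u, t)) c d =
   (d - c)%R * (A + l * u) + l * Ci * ((d ^ 2 - c ^ 2) / 2)%R).
{ intros u _. rewrite <- CRInt_const, <- CRInt_id, <- CRInt_scal by apply Ccont_RtoC.
  rewrite <- CRInt_plus.
  - apply CRInt_ext. intros t. apply injective_projections; simpl; ring.
  - apply Ccont_const.
  - intros t; apply Ccont_mult; [apply Ccont_const|apply Ccont_RtoC]. }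
unfold rect. rewrite !h, !v by exact 0%R.
apply injective_projections; simpl; field.
Qed.

Lemma rect_bound (F : C -> C) (a b c d M : R) : entire F ->
  (a <= b)%R -> (c <= d)%R ->
  (forall s t, (a <= s <= b)%R -> (c <= t <= d)%R -> (Cmod (F (s, t)) <= M)%R) ->
  (Cmod (rect F a b c d) <= 2 * ((b - a) + (d - c)) * M)%R.
Proof.
intros hF hab hcd hM.
assert (b1 := CRInt_bound (fun t => F (t, c)) a b M hab (entire_horizontal F c hF) ltac:(intros; apply hM; lra)).
assert (b2 := CRInt_bound (fun t => F (t, d)) a b M hab (entire_horizontal F d hF) ltac:(intros; apply hM; lra)).
assert (b3 := CRInt_bound (fun t => F (a, t)) c d M hcd (entire_vertical F a hF) ltac:(intros; apply hM; lra)).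
assert (b4 := CRInt_bound (fun t => F (b, t)) c d M hcd (entire_vertical F b hF) ltac:(intros; apply hM; lra)).
unfold rect, Cminus.
eapply Rle_trans; [apply Cmod_triangle|].
rewrite Cmod_mult, Cmod_Ci.
assert (t1 := Cmod_triangle (CRInt (fun t => F (t, c)) a b) (- CRInt (fun t => F (t, d)) a b)).
assert (t2 := Cmod_triangle (CRInt (fun t => F (b, t)) c d) (- CRInt (fun t => F (a, t)) c d)).
rewrite Cmod_opp in t1, t2. lra.
Qed.

Lemma goursat (H : C -> C) (a b c d : R) : entire H -> (a <= b)%R -> (c <= d)%R ->
  rect H a b c d = 0.
Proof.
intros hH hab hcd. apply Cmod_eq_0.
assert (hL : (0 <= (b - a + (d - c)) ^ 2)%R) by (apply pow2_ge_0).
apply Rle_antisym; [|apply Cmod_ge_0].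
apply le_epsilon; intros eps heps.
pose (eta := (eps / ((b - a + (d - c)) ^ 2 + 1))%R).
assert (heta : (0 < eta)%R) by (apply Rdiv_lt_0_compat; lra).
apply Rle_trans with (eta * ((b - a) + (d - c)) ^ 2)%R.
2:{ rewrite Rplus_0_l. apply Rle_trans with (eta * ((b - a + (d - c)) ^ 2 + 1))%R; [nra|].
    right; unfold eta; field; lra. }
apply (rectangle_bisection (rect H)); auto.
- intros a' b' c' d' e. unfold rect.
  rewrite (CRInt_Chasles (fun t => H (t, c')) a' e b'), (CRInt_Chasles (fun t => H (t, d')) a' e b')
    by (apply entire_horizontal; assumption). ring.
- intros a' b' c' d' e. unfold rect.
  rewrite (CRInt_Chasles (fun t => H (a', t)) c' e d'), (CRInt_Chasles (fun t => H (b', t)) c' e d')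
    by (apply entire_vertical; assumption). ring.
- intros p1 p2. destruct (hH (p1, p2)) as [l hl].
  (* Half of [eta], because the perimeter in [rect_bound] is twice the sum of the sides. *)
  destruct (hl (eta / 2)%R ltac:(lra)) as (r & hr & Hr).
  exists r; split; [exact hr|]. intros a' b' c' d' h1 h2 hs.
  pose (p := (p1, p2) : C). pose (A := H p - l * p).
  (* [E] is H minus its first order expansion at p. By [rect_affine] the contour integral is
     unchanged, and |E| is at most eta / 2 times the sum of the sides. *)
  pose (E := fun w => H w + ((- A) + (- l) * w)).
  assert (hE : entire E) by (apply entire_plus; [exact hH|apply entire_affine]).
  replace (rect H a' b' c' d') with (rect E a' b' c' d')
    by (unfold E; rewrite rect_plus, rect_affine by (auto using entire_affine); ring).
  eapply Rle_trans; [apply (rect_bound E a' b' c' d' (eta / 2 * (b' - a' + (d' - c')))%R hE); try lra|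
    right; simpl; field].
  intros s t hs' ht.
  assert (hd : (Cmod ((s, t) - p) <= b' - a' + (d' - c'))%R).
  { replace ((s, t) - p) with ((s - p1)%R + Ci * (t - p2)%R)
      by (apply injective_projections; simpl; ring).
    eapply Rle_trans; [apply Cmod_triangle|]. rewrite Cmod_mult, Cmod_Ci, !Cmod_R, Rmult_1_l.
    apply Rplus_le_compat; apply Rabs_le; lra. }
  replace (E (s, t)) with (H (s, t) - H p - l * ((s, t) - p)) by (unfold E, A; ring).
  eapply Rle_trans; [apply (Hr (s, t)); exact (Rle_lt_trans _ _ _ hd hs)|].
  apply Rmult_le_compat_l; [lra|exact hd].
Qed.

(** * The complex exponential and circle means *)

Definition cis (t : R) : C := (cos t, sin t).

Definition Cexp (w : C) : C := RtoC (exp (fst w)) * cis (snd w).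

Lemma cis_plus (s t : R) : cis (s + t) = cis s * cis t.
Proof.
unfold cis; rewrite cos_plus, sin_plus; apply injective_projections; simpl; ring.
Qed.

Lemma cis_0 : cis 0 = 1.
Proof. unfold cis; now rewrite cos_0, sin_0. Qed.

Lemma cis_PI : cis PI = - (1).
Proof. unfold cis; rewrite cos_PI, sin_PI; apply injective_projections; simpl; ring. Qed.

Lemma cis_2PI : cis (2 * PI) = 1.
Proof. unfold cis; now rewrite cos_2PI, sin_2PI. Qed.

Lemma Cmod_cis (t : R) : Cmod (cis t) = 1%R.
Proof.
unfold Cmod, cis. change (sqrt (cos t ^ 2 + sin t ^ 2) = 1%R).
replace (cos t ^ 2 + sin t ^ 2)%R with 1%R; [apply sqrt_1|].
rewrite <- (sin2_cos2 t); unfold Rsqr; ring.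
Qed.

Lemma cis_neq_0 (t : R) : cis t <> 0.
Proof. apply Cmod_gt_0; rewrite Cmod_cis; lra. Qed.

Lemma Cexp_plus (z w : C) : Cexp (z + w) = Cexp z * Cexp w.
Proof. unfold Cexp; simpl. rewrite exp_plus, cis_plus, RtoC_mult. ring. Qed.

Lemma Cexp_neq_0 (z : C) : Cexp z <> 0.
Proof.
apply Cmult_neq_0; [|apply cis_neq_0].
intros h; apply (f_equal fst) in h; simpl in h. assert (p := exp_pos (fst z)). lra.
Qed.

Lemma first_order (f : R -> R) (l : R) : derivable_pt_lim f 0 l ->
  forall eps, (0 < eps)%R -> exists d, (0 < d)%R /\ forall h, (Rabs h < d)%R ->
    (Rabs (f h - f 0 - l * h) <= eps * Rabs h)%R.
Proof.
intros hf eps heps. destruct (hf eps heps) as [d Hd].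
exists d; split; [apply cond_pos|]. intros h hh.
destruct (Req_dec h 0) as [->|hne].
- replace (f 0 - f 0 - l * 0)%R with 0%R by ring. rewrite Rabs_R0. lra.
- specialize (Hd h hne hh). rewrite Rplus_0_l in Hd.
  replace (f h - f 0 - l * h)%R with (((f h - f 0) / h - l) * h)%R by (field; exact hne).
  rewrite Rabs_mult. apply Rmult_le_compat_r; [apply Rabs_pos|lra].
Qed.

Lemma Cmod_le_sum (z : C) : (Cmod z <= Rabs (fst z) + Rabs (snd z))%R.
Proof.
destruct z as [a b]; simpl.
replace (a, b) with (RtoC a + Ci * RtoC b) by (apply injective_projections; simpl; ring).
eapply Rle_trans; [apply Cmod_triangle|]. rewrite Cmod_mult, Cmod_Ci, !Cmod_R. lra.
Qed.

Lemma Rabs_fst_le (z : C) : (Rabs (fst z) <= Cmod z)%R.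
Proof. eapply Rle_trans; [apply Rmax_l|apply Rmax_Cmod]. Qed.

Lemma Rabs_snd_le (z : C) : (Rabs (snd z) <= Cmod z)%R.
Proof. eapply Rle_trans; [apply Rmax_r|apply Rmax_Cmod]. Qed.

Lemma Cder_exp_0 : Cder Cexp 0 1.
Proof.
(* 9 = 3 + 3 + 2 + 1: the errors of cos and sin, each multiplied by exp s <= 3, then the product
   (exp s - 1) t, then the error of exp itself. The bound [e <= 1] is what gives exp s <= 3. *)
intros eps heps. pose (e := Rmin 1 (eps / 9)).
assert (he : (0 < e)%R) by (apply Rmin_pos; lra).
assert (he1 : (e <= 1)%R) by apply Rmin_l.
assert (he2 : (e <= eps / 9)%R) by apply Rmin_r.
destruct (first_order exp 1 derivable_pt_lim_exp_0 e he) as (d1 & hd1 & H1).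
assert (c0 := derivable_pt_lim_cos 0). rewrite sin_0, Ropp_0 in c0.
assert (s0 := derivable_pt_lim_sin 0). rewrite cos_0 in s0.
destruct (first_order cos 0 c0 e he) as (d2 & hd2 & H2).
destruct (first_order sin 1 s0 e he) as (d3 & hd3 & H3).
exists (Rmin e (Rmin d1 (Rmin d2 d3))). split; [repeat (apply Rmin_pos; [assumption|]); assumption|].
intros w hw. replace (w - 0) with w in * by ring.
destruct w as [s t].
assert (hs := Rabs_fst_le (s, t)). assert (ht := Rabs_snd_le (s, t)). simpl in hs, ht.
set (r := Cmod (s, t)) in *.
assert (m1 := Rmin_l e (Rmin d1 (Rmin d2 d3))).
assert (m2 := Rmin_r e (Rmin d1 (Rmin d2 d3))).
assert (m3 := Rmin_l d1 (Rmin d2 d3)). assert (m4 := Rmin_r d1 (Rmin d2 d3)).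
assert (m5 := Rmin_l d2 d3). assert (m6 := Rmin_r d2 d3).
specialize (H1 s ltac:(lra)). specialize (H2 t ltac:(lra)). specialize (H3 t ltac:(lra)).
rewrite exp_0 in H1. rewrite cos_0 in H2. rewrite sin_0 in H3.
assert (pe := exp_pos s).
assert (ps := Rabs_pos s). assert (pt := Rabs_pos t).
assert (e1 : (Rabs (exp s - 1) <= 2 * Rabs s)%R).
{ replace (exp s - 1)%R with ((exp s - 1 - 1 * s) + s)%R by ring.
  eapply Rle_trans; [apply Rabs_triang|]. nra. }
assert (e2 : (exp s <= 3)%R).
{ assert (q := Rle_abs (exp s - 1)). lra. }
replace (Cexp (s, t) - Cexp 0 - 1 * (s, t)) with
  ((exp s * (cos t - 1 - 0 * t) + (exp s - 1 - 1 * s))%R,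
   (exp s * (sin t - 0 - 1 * t) + (exp s - 1) * t)%R).
2:{ unfold Cexp, cis; simpl. rewrite exp_0, cos_0, sin_0. apply injective_projections; simpl; ring. }
eapply Rle_trans; [apply Cmod_le_sum|]. simpl.
assert (a1 := Rabs_triang (exp s * (cos t - 1 - 0 * t)) (exp s - 1 - 1 * s)).
assert (a2 := Rabs_triang (exp s * (sin t - 0 - 1 * t)) ((exp s - 1) * t)).
rewrite !Rabs_mult, (Rabs_pos_eq (exp s)) in a1 by lra.
rewrite !Rabs_mult, (Rabs_pos_eq (exp s)) in a2 by lra.
assert (b1 : (exp s * Rabs (cos t - 1 - 0 * t) <= 3 * (e * r))%R).
{ apply Rmult_le_compat; [lra|apply Rabs_pos|lra|]. eapply Rle_trans; [exact H2|].
  apply Rmult_le_compat_l; lra. }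
assert (b2 : (exp s * Rabs (sin t - 0 - 1 * t) <= 3 * (e * r))%R).
{ apply Rmult_le_compat; [lra|apply Rabs_pos|lra|]. eapply Rle_trans; [exact H3|].
  apply Rmult_le_compat_l; lra. }
assert (b3 : (Rabs (exp s - 1) * Rabs t <= (2 * e) * r)%R).
{ apply Rmult_le_compat; [apply Rabs_pos|lra|lra|lra]. }
assert (b4 : (e * Rabs s <= e * r)%R) by (apply Rmult_le_compat_l; lra).
assert (b5 : (9 * (e * r) <= eps * r)%R).
{ replace (9 * (e * r))%R with (9 * e * r)%R by ring. apply Rmult_le_compat_r; lra. }
lra.
Qed.

Lemma Cder_exp (z : C) : Cder Cexp z (Cexp z).
Proof.
intros eps heps.
assert (hm := proj1 (Cmod_gt_0 _) (Cexp_neq_0 z)).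
destruct (Cder_exp_0 (eps / Cmod (Cexp z))%R) as (d & hd & H);
  [apply Rdiv_lt_0_compat; lra|].
exists d; split; [exact hd|]. intros w hw.
specialize (H (w - z)). replace (w - z - 0) with (w - z) in H by ring. specialize (H hw).
replace (Cexp w - Cexp z - Cexp z * (w - z)) with
  (Cexp z * (Cexp (w - z) - Cexp 0 - 1 * (w - z))).
2:{ replace w with (z + (w - z)) at 3 by ring. rewrite Cexp_plus.
    unfold Cexp at 3; simpl. rewrite exp_0, cis_0. ring. }
rewrite Cmod_mult. apply Rmult_le_compat_l with (r := Cmod (Cexp z)) in H; [|lra].
eapply Rle_trans; [exact H|]. right; field; lra.
Qed.

Lemma entire_comp_exp (F : C -> C) : holomorphic F -> entire (fun w => F (Cexp w)).
Proof.
intros hF z. destruct (hF (Cexp z) (Cexp_neq_0 z)) as [l hl].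
exists (Cexp z * l). apply Cder_is_derive.
apply (is_derive_comp (K := C_AbsRing) (V := C_NormedModule) F Cexp z l (Cexp z) hl).
apply is_derive_C, Cder_is_derive, Cder_exp.
Qed.

Lemma polar (z : C) : z <> 0 -> exists x t : R, z = Cexp (x, t).
Proof.
intros hz. assert (hm := proj1 (Cmod_gt_0 _) hz).
assert (h2 : (fst z ^ 2 + snd z ^ 2 = Cmod z ^ 2)%R).
{ symmetry; apply Cmod2_alt. }
pose (u := (fst z / Cmod z)%R). pose (v := (snd z / Cmod z)%R).
assert (huv : (u * u + v * v = 1)%R).
{ unfold u, v. replace (fst z / Cmod z * (fst z / Cmod z) + snd z / Cmod z * (snd z / Cmod z))%R
    with ((fst z ^ 2 + snd z ^ 2) / Cmod z ^ 2)%R by (field; lra).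
  rewrite h2; field; lra. }
assert (hu : (-1 <= u <= 1)%R) by nra.
assert (ha : exists t, cos t = u /\ sin t = v).
{ destruct (Rle_dec 0 v) as [hv|hv].
  - exists (acos u); split; [apply cos_acos; exact hu|].
    rewrite sin_acos by exact hu. replace (1 - Rsqr u)%R with (Rsqr v) by (unfold Rsqr; lra).
    apply sqrt_Rsqr, hv.
  - exists (- acos u)%R; split; [rewrite cos_neg; apply cos_acos; exact hu|].
    rewrite sin_neg, sin_acos by exact hu.
    replace (1 - Rsqr u)%R with (Rsqr (- v)) by (unfold Rsqr; lra).
    rewrite sqrt_Rsqr; lra. }
destruct ha as (t & h3 & h4). exists (ln (Cmod z)), t.
unfold Cexp, cis; simpl. rewrite exp_ln, h3, h4 by exact hm.
unfold u, v; apply injective_projections; simpl; field; lra.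
Qed.

Definition mean (F : C -> C) : C :=
  RtoC (/ (2 * PI)) * CRInt (fun t => F (cis t)) 0 (2 * PI).

Definition circle_cont (F : C -> C) : Prop := forall t : R, Ccont (fun s => F (cis s)) t.

Lemma CRInt_period (f : R -> C) (T a : R) :
  (forall t : R, Ccont f t) -> (forall t, f (t + T)%R = f t) ->
  CRInt f a (a + T) = CRInt f 0 T.
Proof.
intros hf hp.
rewrite (CRInt_Chasles f a 0 (a + T) hf), (CRInt_Chasles f 0 T (a + T) hf).
assert (h := CRInt_shift f 0 a T hf). rewrite Rplus_0_l in h. rewrite <- h.
rewrite (CRInt_ext _ f 0 a hp).
assert (h2 := CRInt_Chasles f 0 a 0 hf). assert (h3 := CRInt_Chasles f 0 0 0 hf).
assert (h4 : CRInt f 0 0 = 0).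
{ replace (CRInt f 0 0) with (CRInt f 0 0 + CRInt f 0 0 - CRInt f 0 0) by ring. rewrite <- h3. ring. }
rewrite h4 in h2. replace (CRInt f a 0) with (- CRInt f 0 a).
- ring.
- replace (CRInt f a 0) with (CRInt f 0 a + CRInt f a 0 - CRInt f 0 a) by ring. rewrite <- h2; ring.
Qed.

Lemma twoPI_neq_0 : RtoC (/ (2 * PI)) * RtoC (2 * PI) = 1.
Proof.
rewrite <- RtoC_mult. f_equal. apply Rinv_l. assert (h := PI_RGT_0). lra.
Qed.

Lemma cis_period (t : R) : cis (t + 2 * PI) = cis t.
Proof. rewrite cis_plus, cis_2PI; ring. Qed.

Lemma mean_ext (F G : C -> C) : (forall z, Cmod z = 1%R -> F z = G z) -> mean F = mean G.
Proof. intros h; unfold mean; f_equal; apply CRInt_ext; intros t; apply h, Cmod_cis. Qed.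

Lemma mean_rotate (F : C -> C) (a : R) : circle_cont F ->
  mean (fun z => F (cis a * z)) = mean F.
Proof.
intros hF; unfold mean; f_equal.
rewrite <- (CRInt_period (fun t => F (cis t)) (2 * PI) a hF) by (intros; now rewrite cis_period).
assert (h := CRInt_shift (fun t => F (cis t)) 0 (2 * PI) a hF).
rewrite Rplus_0_l in h. rewrite (Rplus_comm a (2 * PI)), <- h.
apply CRInt_ext; intros t. now rewrite Rplus_comm, cis_plus.
Qed.

(** In the coordinate log z take the rectangle of height 2 PI over [a, b]. Its horizontal sides
    cancel by periodicity, so [goursat] equates the vertical ones, which are the means over the
    circles of radii exp a and exp b. *)
Lemma mean_dilate_exp (F : C -> C) (x : R) : holomorphic F ->
  mean (fun z => F (RtoC (exp x) * z)) = mean F.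
Proof.
intros hF. unfold mean; f_equal.
pose (G := fun w => F (Cexp w)). assert (hG := entire_comp_exp F hF). fold G in hG.
assert (key : forall a b, (a <= b)%R -> CRInt (fun t => G (b, t)) 0 (2 * PI) = CRInt (fun t => G (a, t)) 0 (2 * PI)).
{ intros a b hab. assert (hp := PI_RGT_0).
  assert (h := goursat G a b 0 (2 * PI) hG hab ltac:(lra)). unfold rect in h.
  rewrite (CRInt_ext (fun t => G (t, (2 * PI)%R)) (fun t => G (t, 0%R))) in h.
  2:{ intros t. unfold G, Cexp; simpl. now rewrite cis_2PI, cis_0. }
  set (u := CRInt _ 0 _) in h |- *. set (v := CRInt (fun t => G (a, t)) 0 _) in h |- *.
  replace u with ((u - v) + v) by ring.
  replace (u - v) with (- Ci * (Ci * (u - v))).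
  - replace (Ci * (u - v)) with (CRInt (fun t => G (t, 0%R)) a b - CRInt (fun t => G (t, 0%R)) a b + Ci * (u - v)) by ring.
    rewrite h; ring.
  - replace (- Ci * (Ci * (u - v))) with (- (Ci * Ci) * (u - v)) by ring.
    replace (Ci * Ci) with (- (1)) by (apply injective_projections; simpl; ring). ring. }
transitivity (CRInt (fun t => G (x, t)) 0 (2 * PI)).
- apply CRInt_ext; reflexivity.
- transitivity (CRInt (fun t => G (0%R, t)) 0 (2 * PI)).
  + destruct (Rle_dec 0 x); [apply key; assumption|symmetry; apply key; lra].
  + apply CRInt_ext; intros t. unfold G, Cexp; simpl. rewrite exp_0. f_equal; ring.
Qed.

Lemma holomorphic_scale (F : C -> C) (c : C) : c <> 0 ->
  holomorphic F -> holomorphic (fun z => F (c * z)).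
Proof.
intros hc hF z hz. destruct (hF (c * z) (Cmult_neq_0 _ _ hc hz)) as [l hl].
exists (c * l).
apply (is_derive_comp (K := C_AbsRing) (V := C_NormedModule) F (fun z => c * z) z l c hl).
apply is_derive_C, Cder_is_derive. intros eps heps; exists 1%R; split; [lra|].
intros w _. replace (c * w - c * z - c * (w - z)) with (RtoC 0) by ring.
rewrite Cmod_0. assert (h := Cmod_ge_0 (w - z)). nra.
Qed.

Lemma holomorphic_circle_cont (F : C -> C) : holomorphic F -> circle_cont F.
Proof.
intros hF t.
apply Ccont_ext with (2 := entire_vertical _ 0 (entire_comp_exp F hF) t).
intros s. unfold Cexp; simpl. rewrite exp_0. f_equal; ring.
Qed.

Lemma mean_dilate (F : C -> C) (z : C) : z <> 0 -> holomorphic F ->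
  mean (fun w => F (z * w)) = mean F.
Proof.
intros hz hF. destruct (polar z hz) as (x & t & ->).
rewrite <- (mean_dilate_exp F x hF).
rewrite <- (mean_rotate (fun w => F (exp x * w)) t).
- apply mean_ext; intros w _. unfold Cexp; simpl. f_equal; ring.
- apply holomorphic_circle_cont, holomorphic_scale; [|exact hF].
  intros h; apply (f_equal fst) in h; simpl in h. assert (p := exp_pos x). lra.
Qed.

(** * Fourier coefficients on the unit circle *)

Lemma Cpowz_succ (z : C) (n : Z) : z <> 0 -> z ^^ (Z.succ n) = z * z ^^ n.
Proof.
intros hz.
assert (hp : forall p, z ^ Pos.to_nat p <> 0) by (intros; now apply Cpow_ne).
destruct n as [|p|p].
- simpl. ring.
- change (Z.succ (Z.pos p)) with (Z.pos (p + 1)). simpl.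
  rewrite Pos2Nat.inj_add, Cpow_add_r. simpl. ring.
- destruct (Pos.eq_dec p 1) as [->|hne].
  + simpl. field; exact hz.
  + replace p with (Pos.succ (Pos.pred p)) by (apply Pos.succ_pred; exact hne).
    replace (Z.succ (Z.neg (Pos.succ (Pos.pred p)))) with (Z.neg (Pos.pred p)) by lia.
    simpl. rewrite Pos2Nat.inj_succ. simpl. field. auto.
Qed.

Lemma Cpowz_neq_0 (z : C) (n : Z) : z <> 0 -> z ^^ n <> 0.
Proof.
intros hz. destruct n as [|p|p]; simpl.
- intros h; apply (f_equal fst) in h; simpl in h; lra.
- now apply Cpow_ne.
- apply Cmod_gt_0. rewrite Cmod_inv by (now apply Cpow_ne).
  apply Rinv_0_lt_compat, Cmod_gt_0. now apply Cpow_ne.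
Qed.

Lemma Cpowz_pred (z : C) (n : Z) : z <> 0 -> z ^^ (Z.pred n) = / z * z ^^ n.
Proof.
intros hz. rewrite <- (Z.succ_pred n) at 2. rewrite Cpowz_succ by exact hz. field; exact hz.
Qed.

Lemma Cpowz_add (z : C) (m n : Z) : z <> 0 -> z ^^ (m + n) = z ^^ m * z ^^ n.
Proof.
intros hz. revert m. apply Z.peano_ind.
- simpl. ring.
- intros m IH. rewrite Z.add_succ_l, !Cpowz_succ, IH by exact hz. ring.
- intros m IH. rewrite Z.add_pred_l, !Cpowz_pred, IH by exact hz. ring.
Qed.

Lemma Cpowz_opp (z : C) (n : Z) : z <> 0 -> z ^^ (- n) = / z ^^ n.
Proof.
intros hz. assert (h := Cpowz_neq_0 z n hz).
replace (z ^^ (- n)) with (z ^^ (- n) * z ^^ n * / z ^^ n) by (field; exact h).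
rewrite <- Cpowz_add by exact hz. rewrite Z.add_opp_diag_l. simpl. field; exact h.
Qed.

Lemma Cpowz_mult (z w : C) (n : Z) : z <> 0 -> w <> 0 -> (z * w) ^^ n = z ^^ n * w ^^ n.
Proof.
intros hz hw. assert (hzw := Cmult_neq_0 _ _ hz hw). revert n. apply Z.peano_ind.
- simpl. ring.
- intros n IH. rewrite !Cpowz_succ, IH by assumption. ring.
- intros n IH. rewrite !Cpowz_pred, IH by assumption. field; auto.
Qed.

Lemma Cpowz_nat (z : C) (n : nat) : z ^^ (Z.of_nat n) = z ^ n.
Proof. destruct n as [|n]; [reflexivity|]. simpl. now rewrite SuccNat2Pos.id_succ. Qed.

Lemma Cpowz_cis (t : R) (n : Z) : cis t ^^ n = cis (IZR n * t).
Proof.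
revert n; apply Z.peano_ind.
- rewrite Rmult_0_l, cis_0; reflexivity.
- intros n IH. rewrite Cpowz_succ, IH by apply cis_neq_0.
  rewrite succ_IZR, <- cis_plus. f_equal; ring.
- intros n IH. rewrite Cpowz_pred, IH by apply cis_neq_0.
  rewrite <- Z.sub_1_r, minus_IZR. replace (IZR n * t)%R with (t + (IZR n - 1) * t)%R by ring.
  rewrite cis_plus. field. apply cis_neq_0.
Qed.

Lemma Cmod1_neq_0 (z : C) : Cmod z = 1%R -> z <> 0.
Proof. intros h; apply Cmod_gt_0; lra. Qed.

Lemma Cmod_pow1 (z : C) (n : nat) : Cmod z = 1%R -> Cmod (z ^ n) = 1%R.
Proof. intros h. now rewrite Cmod_pow, h, pow1. Qed.

Lemma Cmod_powz1 (z : C) (n : Z) : Cmod z = 1%R -> Cmod (z ^^ n) = 1%R.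
Proof.
intros h; destruct n as [|p|p]; simpl.
- apply Cmod_1.
- now apply Cmod_pow1.
- rewrite Cmod_inv, Cmod_pow1, Rinv_1 by (try apply Cpow_ne; try apply Cmod1_neq_0; exact h). reflexivity.
Qed.

Lemma is_derive_Cinv (z : C) : z <> 0 ->
  is_derive (K := C_AbsRing) (V := C_NormedModule) Cinv z (- / (z * z)).
Proof.
intros hz. apply Cder_is_derive. intros eps heps.
assert (hm := proj1 (Cmod_gt_0 _) hz). set (r := Cmod z) in *.
exists (Rmin (r / 2) (eps * r ^ 3 / 2)). split.
{ apply Rmin_pos; [lra|]. assert (h := pow_lt r 3 hm). nra. }
intros w hw.
assert (h1 := Rlt_le_trans _ _ _ hw (Rmin_l _ _)).
assert (h2 := Rlt_le_trans _ _ _ hw (Rmin_r _ _)).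
assert (hwr : (r / 2 <= Cmod w)%R).
{ assert (t := Cmod_triangle w (- (w - z))). rewrite Cmod_opp in t.
  replace (w + - (w - z)) with z in t by ring. fold r in t. lra. }
assert (hw0 : w <> 0) by (apply Cmod_gt_0; lra).
replace (/ w - / z - - / (z * z) * (w - z)) with
  ((w - z) * ((w - z) * / (w * (z * z)))) by (field; auto).
rewrite (Cmod_mult (w - z)), (Rmult_comm eps). apply Rmult_le_compat_l; [apply Cmod_ge_0|].
rewrite Cmod_mult, Cmod_inv, !Cmod_mult by (repeat apply Cmult_neq_0; auto). fold r.
assert (p3 : (0 < r ^ 3)%R) by (now apply pow_lt).
assert (hden : (r ^ 3 / 2 <= Cmod w * (r * r))%R).
{ replace (r ^ 3 / 2)%R with (r / 2 * (r * r))%R by field. apply Rmult_le_compat_r; nra. }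
apply Rmult_le_reg_r with (Cmod w * (r * r))%R; [nra|].
rewrite Rmult_assoc, Rinv_l, Rmult_1_r by nra.
apply Rle_trans with (eps * (r ^ 3 / 2))%R; [lra|]. apply Rmult_le_compat_l; lra.
Qed.

Lemma holomorphic_powz (n : Z) : holomorphic (fun z => z ^^ n).
Proof.
destruct n as [|p|p]; simpl.
- apply holomorphic_cst.
- apply holomorphic_pow.
- intros z hz. destruct (holomorphic_pow (Pos.to_nat p) z hz) as [l hl].
  exists (l * (- / (z ^ Pos.to_nat p * z ^ Pos.to_nat p))).
  apply (is_derive_comp (K := C_AbsRing) (V := C_NormedModule) Cinv (fun z => z ^ Pos.to_nat p)).
  + apply is_derive_Cinv. now apply Cpow_ne.
  + apply is_derive_C, hl.
Qed.

Lemma circle_cont_plus (F G : C -> C) : circle_cont F -> circle_cont G -> circle_cont (fun z => F z + G z).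
Proof. intros hF hG t; apply Ccont_plus; auto. Qed.

Lemma circle_cont_mult (F G : C -> C) : circle_cont F -> circle_cont G -> circle_cont (fun z => F z * G z).
Proof. intros hF hG t; apply (Ccont_mult (fun s => F (cis s)) (fun s => G (cis s))); auto. Qed.

Lemma circle_cont_const (c : C) : circle_cont (fun _ => c).
Proof. intros t; apply Ccont_const. Qed.

Lemma circle_cont_powz (n : Z) : circle_cont (fun z => z ^^ n).
Proof. apply holomorphic_circle_cont, holomorphic_powz. Qed.

Lemma mean_plus (F G : C -> C) : circle_cont F -> circle_cont G ->
  mean (fun z => F z + G z) = mean F + mean G.
Proof.
intros hF hG. unfold mean.
rewrite (CRInt_plus (fun t => F (cis t)) (fun t => G (cis t))) by assumption. ring.
Qed.

Lemma mean_scal (F : C -> C) (c : C) : circle_cont F -> mean (fun z => c * F z) = c * mean F.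
Proof.
intros hF. unfold mean. rewrite (CRInt_scal (fun t => F (cis t))) by assumption. ring.
Qed.

Lemma mean_const (c : C) : mean (fun _ => c) = c.
Proof.
unfold mean. rewrite CRInt_const, Rminus_0_r, Cmult_assoc, twoPI_neq_0. ring.
Qed.

Lemma mean_bound (F : C -> C) (M : R) : circle_cont F ->
  (forall t, (0 <= t <= 2 * PI)%R -> (Cmod (F (cis t)) <= M)%R) -> (Cmod (mean F) <= M)%R.
Proof.
intros hF hM. unfold mean. assert (hp := PI_RGT_0).
rewrite Cmod_mult, Cmod_R, Rabs_pos_eq by (left; apply Rinv_0_lt_compat; lra).
assert (h := CRInt_bound (fun t => F (cis t)) 0 (2 * PI) M ltac:(lra) hF hM).
rewrite Rminus_0_r in h.
apply Rmult_le_reg_l with (2 * PI)%R; [lra|].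
rewrite <- Rmult_assoc, Rinv_r, Rmult_1_l by lra. exact h.
Qed.

(** Rotation invariance makes the mean equal to its opposite. For z^n the rotation by PI / n does
    this, which yields the orthogonality of the powers. *)
Lemma mean_antirotate (F : C -> C) (a : R) : circle_cont F ->
  (forall z, Cmod z = 1%R -> F (cis a * z) = - F z) -> mean F = 0.
Proof.
intros hF h. assert (e := mean_rotate F a hF).
rewrite (mean_ext _ (fun z => - (1) * F z)) in e.
2:{ intros z hz; rewrite h by exact hz; ring. }
rewrite mean_scal in e by exact hF.
assert (e2 : 2 * mean F = 0).
{ replace (2 * mean F) with (mean F - - (1) * mean F) by ring. rewrite e; ring. }
replace (mean F) with (/ 2 * (2 * mean F)).
- rewrite e2; ring.
- field.
Qed.

Lemma mean_powz (n : Z) : n <> 0%Z -> mean (fun z => z ^^ n) = 0.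
Proof.
intros hn. apply (mean_antirotate _ (PI / IZR n)); [apply circle_cont_powz|].
intros z hz. assert (h : IZR n <> 0%R) by (now apply not_0_IZR).
rewrite Cpowz_mult, Cpowz_cis by (try apply cis_neq_0; now apply Cmod1_neq_0).
replace (IZR n * (PI / IZR n))%R with PI by (field; exact h). rewrite cis_PI; ring.
Qed.

Definition fourier (F : C -> C) (n : Z) : C := mean (fun z => F z * z ^^ (- n)).

(** Rotation by a = - PI / n changes the sign of z^(-n). Hence twice the coefficient is the mean of
    (g(z) - g(cis a z)) z^(-n), which uniform continuity makes small. *)
Lemma riemann_lebesgue (g : C -> C) : circle_cont g ->
  forall eps, (0 < eps)%R -> exists N : nat, forall n : Z, (Z.of_nat N <= Z.abs n)%Z ->
    (Cmod (fourier g n) <= eps)%R.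
Proof.
intros hg eps heps. assert (hp := PI_RGT_0). assert (hp4 := PI_4).
(* The interval [-4, 12] contains t and a + t for 0 <= t <= 2 PI and |a| <= 4, because PI <= 4. *)
destruct (unifcont_normed_1d (V := C_R_NormedModule) (fun t => g (cis t)) (- 4)%R 12%R
  (fun t _ => hg t) (mkposreal eps heps)) as [d Hd].
destruct (archimed_cor1 (d / 4)%R) as (N & hN & hN0); [assert (h := cond_pos d); lra|].
exists N. intros n hn.
assert (hNn : (INR N <= Rabs (IZR n))%R).
{ rewrite <- abs_IZR, INR_IZR_INZ. now apply IZR_le. }
assert (hNpos : (0 < INR N)%R) by (now apply lt_0_INR).
assert (hn0 : IZR n <> 0%R) by (intros h; rewrite h, Rabs_R0 in hNn; lra).
pose (a := (- PI / IZR n)%R).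
assert (ha : (Rabs a <= 4 / INR N)%R).
{ unfold a, Rdiv. rewrite Rabs_mult, Rabs_Ropp, Rabs_inv, (Rabs_pos_eq PI) by lra.
  apply Rmult_le_compat; [lra|left; apply Rinv_0_lt_compat; lra|lra|].
  apply Rinv_le_contravar; lra. }
assert (ha4 : (Rabs a <= 4)%R).
{ eapply Rle_trans; [exact ha|]. assert (1 <= INR N)%R by (apply (le_INR 1); lia).
  apply Rmult_le_reg_r with (INR N); [lra|]. unfold Rdiv. rewrite Rmult_assoc, Rinv_l by lra. lra. }
assert (had : (Rabs a < d)%R) by (unfold Rdiv in *; lra).
pose (G := fun z => g z * z ^^ (- n)).
assert (hG : circle_cont G) by (apply circle_cont_mult; [exact hg|apply circle_cont_powz]).
assert (hgr : circle_cont (fun z => g (cis a * z))).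
{ intros t. assert (hc := hg (a + t)%R). apply Ccont_eps. intros e he.
  destruct (proj1 (Ccont_eps _ _) hc e he) as (r & hr & Hr). exists r; split; [exact hr|].
  intros s hs. rewrite <- !cis_plus. apply Hr. replace (a + s - (a + t))%R with (s - t)%R by ring. exact hs. }
assert (hGr : circle_cont (fun z => g (cis a * z) * z ^^ (- n)))
  by (apply circle_cont_mult; [exact hgr|apply circle_cont_powz]).
assert (e1 : mean (fun z => G (cis a * z)) = - (1) * mean (fun z => g (cis a * z) * z ^^ (- n))).
{ rewrite <- mean_scal by exact hGr. apply mean_ext; intros z hz. unfold G.
  rewrite (Cpowz_mult (cis a) z), Cpowz_cis by (try apply cis_neq_0; now apply Cmod1_neq_0).
  rewrite opp_IZR. replace (- IZR n * a)%R with PI by (unfold a; field; exact hn0).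
  rewrite cis_PI; ring. }
rewrite mean_rotate in e1 by exact hG.
assert (e2 : 2 * fourier g n = mean (fun z => G z + - (1) * (g (cis a * z) * z ^^ (- n)))).
{ assert (hGm := circle_cont_mult _ _ (circle_cont_const (- (1))) hGr).
  rewrite mean_plus, mean_scal, <- e1 by assumption.
  unfold fourier, G; ring. }
assert (b : (Cmod (2 * fourier g n) <= eps)%R).
{ rewrite e2. apply mean_bound.
  - apply circle_cont_plus; [exact hG|]. apply circle_cont_mult; [apply circle_cont_const|exact hGr].
  - intros t ht. unfold G.
    replace (g (cis t) * cis t ^^ (- n) + - (1) * (g (cis a * cis t) * cis t ^^ (- n)))
      with ((g (cis t) - g (cis a * cis t)) * cis t ^^ (- n)) by ring.
    rewrite Cmod_mult, (Cmod_powz1 (cis t)), Rmult_1_r, <- cis_plus by apply Cmod_cis.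
    assert (ab := Rabs_def2 a (d) had). assert (ab4 := proj1 (Rabs_le_between a 4) ha4).
    left. rewrite Cmod_norm.
    refine (Hd (a + t)%R t _ _ _); [lra|lra|].
    change (Rabs (t - (a + t)) < d)%R. replace (t - (a + t))%R with (- a)%R by ring.
    rewrite Rabs_Ropp; exact had. }
rewrite Cmod_mult, Cmod_R, Rabs_pos_eq in b by lra.
assert (h := Cmod_ge_0 (fourier g n)). lra.
Qed.

Lemma circle_bounded (F : C -> C) : circle_cont F ->
  exists M, (0 <= M)%R /\ forall t, (0 <= t <= 2 * PI)%R -> (Cmod (F (cis t)) <= M)%R.
Proof.
intros hF. assert (hp := PI_RGT_0).
destruct (continuity_ab_maj (fun t => Cmod (F (cis t))) 0 (2 * PI)) as (m & hm & _); [lra| |].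
- intros t _. apply continuity_pt_locally. intros eps.
  destruct (proj1 (Ccont_eps _ _) (hF t) eps (cond_pos eps)) as (d & hd & Hd).
  exists (mkposreal d hd). intros s hs. specialize (Hd s hs).
  assert (t1 := Cmod_triangle (F (cis t)) (F (cis s) - F (cis t))).
  assert (t2 := Cmod_triangle (F (cis s)) (- (F (cis s) - F (cis t)))).
  rewrite Cmod_opp in t2.
  replace (F (cis t) + (F (cis s) - F (cis t))) with (F (cis s)) in t1 by ring.
  replace (F (cis s) + - (F (cis s) - F (cis t))) with (F (cis t)) in t2 by ring.
  apply Rabs_lt_between; lra.
- exists (Cmod (F (cis m))); split; [apply Cmod_ge_0|exact hm].
Qed.

Lemma fourier_dilate (F : C -> C) (z : C) (n : Z) : z <> 0 -> holomorphic F ->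
  fourier (fun w => F (z * w)) n = fourier F n * z ^^ n.
Proof.
intros hz hF. pose (G := fun w => F w * w ^^ (- n)).
assert (hG : holomorphic G) by (apply holomorphic_mult; [exact hF|apply holomorphic_powz]).
change (fourier F n) with (mean G). rewrite <- (mean_dilate G z hz hG).
rewrite Cmult_comm, <- mean_scal by (apply holomorphic_circle_cont, holomorphic_scale; assumption).
apply mean_ext; intros w hw. unfold G.
rewrite (Cpowz_mult z w), !Cpowz_opp by (try exact hz; now apply Cmod1_neq_0).
field. split; apply Cpowz_neq_0; [now apply Cmod1_neq_0|exact hz].
Qed.

Lemma fourier_bound (F : C -> C) (z : C) : z <> 0 -> holomorphic F ->
  exists M, (0 <= M)%R /\ forall n, (Cmod (fourier F n * z ^^ n) <= M)%R.
Proof.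
intros hz hF.
assert (hc := holomorphic_circle_cont _ (holomorphic_scale F z hz hF)).
destruct (circle_bounded _ hc) as (M & hM0 & hM). exists M; split; [exact hM0|].
intros n. rewrite <- fourier_dilate by assumption. apply mean_bound.
- apply circle_cont_mult; [exact hc|apply circle_cont_powz].
- intros t ht. rewrite Cmod_mult, (Cmod_powz1 (cis t)), Rmult_1_r by apply Cmod_cis. now apply hM.
Qed.

(** * Unconditional sums *)

Section Lists.
Context {I : Type}.
Implicit Types (f : I -> C) (l : list I).

Definition rsum (f : I -> R) (l : list I) : R := fold_right Rplus 0%R (map f l).

Lemma lsum_app f l l' : lsum f (l ++ l') = lsum f l + lsum f l'.
Proof. unfold lsum. induction l as [|i l IH]; simpl; [ring|]. rewrite IH; ring. Qed.

Lemma lsum_perm f l l' : Permutation l l' -> lsum f l = lsum f l'.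
Proof. unfold lsum. induction 1; simpl; try congruence; ring. Qed.

Lemma lsum_ext f f' l : (forall i, In i l -> f i = f' i) -> lsum f l = lsum f' l.
Proof.
unfold lsum. induction l as [|i l IH]; simpl; intros h; [reflexivity|].
rewrite h, IH by auto; reflexivity.
Qed.

Lemma lsum_scal f (c : C) l : lsum (fun i => c * f i) l = c * lsum f l.
Proof. unfold lsum. induction l as [|i l IH]; simpl; [ring|]. rewrite IH; ring. Qed.

Lemma rsum_app (f : I -> R) l l' : rsum f (l ++ l') = (rsum f l + rsum f l')%R.
Proof. unfold rsum. induction l as [|i l IH]; simpl; [ring|]. rewrite IH; ring. Qed.

Lemma rsum_perm (f : I -> R) l l' : Permutation l l' -> rsum f l = rsum f l'.
Proof. unfold rsum. induction 1; simpl; try congruence; ring. Qed.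

Lemma rsum_le (f g : I -> R) l : (forall i, In i l -> (f i <= g i)%R) -> (rsum f l <= rsum g l)%R.
Proof.
unfold rsum. induction l as [|i l IH]; simpl; intros h; [lra|].
apply Rplus_le_compat; auto.
Qed.

Lemma rsum_pos (f : I -> R) l : (forall i, (0 <= f i)%R) -> (0 <= rsum f l)%R.
Proof. intros h. unfold rsum. induction l as [|i l IH]; simpl; [lra|]. specialize (h i). lra. Qed.

Lemma Cmod_lsum f l : (Cmod (lsum f l) <= rsum (fun i => Cmod (f i)) l)%R.
Proof.
unfold lsum, rsum. induction l as [|i l IH]; simpl; [rewrite Cmod_0; lra|].
eapply Rle_trans; [apply Cmod_triangle|]. lra.
Qed.

Lemma fst_lsum f l : fst (lsum f l) = rsum (fun i => fst (f i)) l.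
Proof. unfold lsum, rsum. induction l as [|i l IH]; simpl; [reflexivity|]. now rewrite IH. Qed.

Lemma snd_lsum f l : snd (lsum f l) = rsum (fun i => snd (f i)) l.
Proof. unfold lsum, rsum. induction l as [|i l IH]; simpl; [reflexivity|]. now rewrite IH. Qed.

(** Turns an inclusion of finite index sets into a concatenation, the form in which partial sums are
    compared with their tails. *)
Lemma incl_Permutation l l' : NoDup l -> incl l l' -> exists r, Permutation l' (l ++ r).
Proof.
revert l'; induction l as [|i l IH]; intros l' hl hi; [exists l'; reflexivity|].
inversion hl as [|? ? hn hl']; subst.
destruct (in_split i l' (hi i (or_introl eq_refl))) as (u & v & ->).
destruct (IH (u ++ v) hl') as [r hr].
- intros j hj. assert (h := hi j (or_intror hj)). apply in_app_iff in h. apply in_app_iff.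
  destruct h as [h|[h|h]]; auto. subst; contradiction.
- exists r. rewrite <- Permutation_middle. simpl. now apply perm_skip.
Qed.

(** Membership is decided by [classic], as equality on [I] is not assumed decidable. *)
Lemma dedup l : exists l', NoDup l' /\ incl l l' /\ incl l' l.
Proof.
induction l as [|i l (l' & h1 & h2 & h3)].
- exists []; repeat split; [constructor|intros ? []|intros ? []].
- destruct (classic (In i l)) as [hi|hi].
  + exists l'; repeat split; auto.
    * intros j [<-|hj]; auto.
    * intros j hj; right; auto.
  + exists (i :: l'); repeat split.
    * constructor; auto.
    * intros j [<-|hj]; [now left|right; auto].
    * intros j [<-|hj]; [now left|right; auto].
Qed.

Lemma NoDup_extend l l' : NoDup l -> exists r, NoDup (l ++ r) /\ incl l' (l ++ r) /\ incl r l'.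
Proof.
intros hl. induction l' as [|i l' (r & h1 & h2 & h3)].
- exists []; rewrite app_nil_r; repeat split; [exact hl|intros ? []|intros ? []].
- destruct (classic (In i (l ++ r))) as [hi|hi].
  + exists r; repeat split; auto.
    * intros j [<-|hj]; auto.
    * intros j hj; right; auto.
  + exists (i :: r); repeat split.
    * apply Permutation_NoDup with (i :: l ++ r); [apply Permutation_middle|]. now constructor.
    * intros j [<-|hj]; [apply in_elt|]. assert (h := h2 j hj). rewrite in_app_iff in *. simpl; tauto.
    * intros j [<-|hj]; [now left|right; auto].
Qed.

Lemma NoDup_app_filter (p : I -> bool) l r : NoDup (l ++ r) -> NoDup (l ++ filter p r).
Proof.
revert l; induction r as [|i r IH]; intros l h; simpl; [exact h|].
destruct (p i).
- replace (l ++ i :: filter p r) with ((l ++ [i]) ++ filter p r) by (now rewrite <- app_assoc).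
  apply IH. now rewrite <- app_assoc.
- apply IH. apply NoDup_remove in h. tauto.
Qed.

Lemma rsum_abs_split (f : I -> R) (M : R) r :
  (forall p : I -> bool, (Rabs (rsum f (filter p r)) <= M)%R) ->
  (rsum (fun i => Rabs (f i)) r <= 2 * M)%R.
Proof.
intros h.
pose (p := fun i => if Rle_dec 0 (f i) then true else false).
assert (e : rsum (fun i => Rabs (f i)) r =
  (rsum f (filter p r) - rsum f (filter (fun i => negb (p i)) r))%R).
{ clear h. unfold rsum. induction r as [|i r IH]; simpl; [ring|].
  destruct (p i) eqn:E; unfold p in E; destruct (Rle_dec 0 (f i)); try discriminate; simpl; rewrite IH.
  - rewrite Rabs_pos_eq by assumption. ring.
  - rewrite Rabs_left by lra. ring. }
rewrite e.
assert (h1 := h p). assert (h2 := h (fun i => negb (p i))).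
apply Rabs_le_between in h1. apply Rabs_le_between in h2. lra.
Qed.

Lemma has_sum_unique (A : I -> Prop) f (s s' : C) : has_sum A f s -> has_sum A f s' -> s = s'.
Proof.
intros h h'. destruct (Req_dec (Cmod (s - s')) 0) as [e|e].
- apply Cmod_eq_0 in e. replace s with (s - s' + s') by ring. rewrite e; ring.
- exfalso. assert (p := Cmod_ge_0 (s - s')).
  destruct (h (Cmod (s - s') / 2)%R ltac:(lra)) as (F & hF & H).
  destruct (h' (Cmod (s - s') / 2)%R ltac:(lra)) as (F' & hF' & H').
  destruct (dedup (F ++ F')) as (L & h1 & h2 & h3).
  assert (hA : List.Forall A L).
  { apply Forall_forall; intros i hi. apply h3, in_app_iff in hi.
    destruct hi as [hi|hi]; [exact (proj1 (Forall_forall _ _) hF i hi)|exact (proj1 (Forall_forall _ _) hF' i hi)]. }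
  specialize (H L h1 hA (incl_tran (incl_appl F' (incl_refl F)) h2)).
  specialize (H' L h1 hA (incl_tran (incl_appr F (incl_refl F')) h2)).
  assert (t := Cmod_triangle (- (lsum f L - s)) (lsum f L - s')). rewrite Cmod_opp in t.
  replace (- (lsum f L - s) + (lsum f L - s')) with (s - s') in t by ring. lra.
Qed.

Lemma has_sum_finite (A : I -> Prop) f l : NoDup l -> List.Forall A l ->
  (forall i, A i -> ~ In i l -> f i = 0) -> has_sum A f (lsum f l).
Proof.
intros hl hA h eps heps. exists l; split; [exact hA|]. intros F hF hAF hi.
destruct (incl_Permutation l F hl hi) as [r hr].
rewrite (lsum_perm _ _ _ hr), lsum_app.
replace (lsum f r) with (RtoC 0).
- replace (lsum f l + 0 - lsum f l) with (RtoC 0) by ring. now rewrite Cmod_0.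
- symmetry. rewrite (lsum_ext f (fun i => 0 * f i)); [rewrite lsum_scal; ring|].
  intros i hir. rewrite h; [ring| |].
  + apply (proj1 (Forall_forall _ _) hAF). apply (Permutation_in _ (Permutation_sym hr)).
    apply in_app_iff; now right.
  + intros hil. assert (hn := Permutation_NoDup hr hF).
    destruct (in_split i l hil) as (u & v & ->).
    rewrite <- app_assoc in hn. simpl in hn. apply NoDup_remove_2 in hn. apply hn.
    rewrite !in_app_iff; auto.
Qed.

(* Unconditional convergence in C gives small absolute tails: test the Cauchy
   criterion on the indices where the real (imaginary) part has a given sign. *)
Lemma has_sum_abs_tail f (s : C) (eps : R) : (0 < eps)%R ->
  has_sum (fun _ => True) f s ->
  exists F0, NoDup F0 /\ forall r, NoDup (F0 ++ r) -> (rsum (fun i => Cmod (f i)) r <= eps)%R.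
Proof.
(* Two partial sums within eps / 8 of s differ by at most eps / 4; adding the two signs gives eps /
   2 per coordinate, and the two coordinates give eps. *)
intros heps h. destruct (h (eps / 8)%R ltac:(lra)) as (F & _ & H).
assert (hT : forall l, List.Forall (fun _ : I => True) l) by (intros; apply Forall_forall; auto).
destruct (dedup F) as (F0 & h1 & h2 & _).
exists F0; split; [exact h1|]. intros r hr.
assert (key : forall p, (Cmod (lsum f (filter p r)) <= eps / 4)%R).
{ intros p. assert (a := H F0 h1 (hT _) h2).
  assert (b := H (F0 ++ filter p r) (NoDup_app_filter p F0 r hr) (hT _) (incl_appl _ h2)).
  rewrite lsum_app in b.
  assert (t := Cmod_triangle (lsum f F0 + lsum f (filter p r) - s) (- (lsum f F0 - s))).
  rewrite Cmod_opp in t.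
  replace (lsum f F0 + lsum f (filter p r) - s + - (lsum f F0 - s)) with (lsum f (filter p r)) in t by ring.
  lra. }
assert (a := rsum_abs_split (fun i => fst (f i)) (eps / 4) r
  ltac:(intros p; rewrite <- fst_lsum; eapply Rle_trans; [apply Rabs_fst_le|apply key])).
assert (b := rsum_abs_split (fun i => snd (f i)) (eps / 4) r
  ltac:(intros p; rewrite <- snd_lsum; eapply Rle_trans; [apply Rabs_snd_le|apply key])).
eapply Rle_trans; [apply rsum_le; intros i _; apply Cmod_le_sum|].
assert (e : rsum (fun i => (Rabs (fst (f i)) + Rabs (snd (f i)))%R) r =
  (rsum (fun i => Rabs (fst (f i))) r + rsum (fun i => Rabs (snd (f i))) r)%R).
{ clear. unfold rsum. induction r as [|i r IH]; simpl; [ring|]. rewrite IH; ring. }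
rewrite e. lra.
Qed.

Lemma circle_cont_lsum (f : I -> C -> C) l :
  (forall i, circle_cont (f i)) -> circle_cont (fun z => lsum (fun i => f i z) l).
Proof.
intros h. unfold lsum. induction l as [|i l IH]; simpl; [apply circle_cont_const|].
apply circle_cont_plus; auto.
Qed.

Lemma mean_lsum (f : I -> C -> C) l :
  (forall i, circle_cont (f i)) ->
  mean (fun z => lsum (fun i => f i z) l) = lsum (fun i => mean (f i)) l.
Proof.
intros h. induction l as [|i l IH]; [exact (mean_const 0)|].
unfold lsum in *; simpl. rewrite mean_plus, IH; auto. apply circle_cont_lsum; auto.
Qed.

(** Termwise integration. The terms have modulus |f i| all over the circle, so the absolute tails
    found at the point [cis 0] bound the remainder uniformly. The exponents [e] are left free: they
    are the identity for a Laurent series and l -> 2kl - m for a theta series. *)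
Lemma has_sum_mean f (e : I -> Z) (F G : C -> C) :
  circle_cont F -> circle_cont G ->
  (forall z, Cmod z = 1%R -> has_sum (fun _ => True) (fun i => f i * z ^^ e i) (F z)) ->
  has_sum (fun _ => True) (fun i => f i * mean (fun z => z ^^ e i * G z)) (mean (fun z => F z * G z)).
Proof.
intros hF hG h eps heps.
assert (hT : forall l, List.Forall (fun _ : I => True) l) by (intros; apply Forall_forall; auto).
destruct (circle_bounded G hG) as (M & hM0 & hM).
(* [M + 1] is positive even if G vanishes on the circle; the factor 1/2 gives the strict
   inequality. *)
pose (e' := (eps / (M + 1) / 2)%R).
assert (he' : (0 < e')%R) by (unfold e'; apply Rdiv_lt_0_compat; [apply Rdiv_lt_0_compat|]; lra).
destruct (has_sum_abs_tail (fun i => f i * cis 0 ^^ e i) (F (cis 0)) e' he' (h _ (Cmod_cis 0))) as (F0 & h0 & H0).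
exists F0; split; [apply hT|]. intros L hL _ hi.
assert (tail : forall r, NoDup (L ++ r) -> (rsum (fun i => Cmod (f i)) r <= e')%R).
{ intros r hr. destruct (incl_Permutation F0 L h0 hi) as [u hu].
  assert (h1 : NoDup (F0 ++ (u ++ r))).
  { rewrite app_assoc. apply Permutation_NoDup with (2 := hr). now apply Permutation_app_tail. }
  specialize (H0 _ h1). rewrite rsum_app in H0.
  assert (p : (0 <= rsum (fun i => Cmod (f i * cis 0 ^^ e i)) u)%R) by (apply rsum_pos; intros; apply Cmod_ge_0).
  eapply Rle_trans; [apply rsum_le with (g := fun i => Cmod (f i * cis 0 ^^ e i))|lra].
  intros i _. rewrite Cmod_mult, Cmod_powz1 by apply Cmod_cis. lra. }
(* F z is approached by sums over extensions of L by new indices only. Whatever extension z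
   requires, the added part is bounded by the same [e']. *)
assert (unif : forall z, Cmod z = 1%R -> (Cmod (F z - lsum (fun i => (f i * z ^^ e i)%C) L) <= e')%R).
{ intros z hz. apply le_epsilon; intros eta heta.
  destruct (h z hz eta heta) as (F2 & _ & H2).
  destruct (NoDup_extend L F2 hL) as (r & h1 & h2 & h3).
  specialize (H2 (L ++ r) h1 (hT _) h2). rewrite lsum_app in H2.
  set (S := lsum (fun i => (f i * z ^^ e i)%C) L) in *. set (T := lsum (fun i => (f i * z ^^ e i)%C) r) in *.
  assert (hTr : (Cmod T <= e')%R).
  { eapply Rle_trans; [apply Cmod_lsum|]. eapply Rle_trans; [apply rsum_le with (g := fun i => Cmod (f i))|now apply tail].
    intros i _. rewrite Cmod_mult, Cmod_powz1 by exact hz. lra. }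
  replace (F z - S) with (T + - (S + T - F z)) by ring.
  eapply Rle_trans; [apply Cmod_triangle|]. rewrite Cmod_opp. lra. }
pose (P := fun z => lsum (fun i => (f i * z ^^ e i)%C) L).
assert (hP : circle_cont P).
{ apply circle_cont_lsum; intros i. apply circle_cont_mult; [apply circle_cont_const|apply circle_cont_powz]. }
assert (cg : forall i, circle_cont (fun z => z ^^ e i * G z))
  by (intros; apply circle_cont_mult; [apply circle_cont_powz|exact hG]).
replace (lsum (fun i => (f i * mean (fun z => (z ^^ e i * G z)%C))%C) L - mean (fun z => F z * G z))
  with (mean (fun z => - (1) * ((F z + - (1) * P z) * G z))).
- apply Rle_lt_trans with (e' * M)%R.
  + apply mean_bound.
    * apply circle_cont_mult; [apply circle_cont_const|]. apply circle_cont_mult; [|exact hG].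
      apply circle_cont_plus; [exact hF|]. apply circle_cont_mult; [apply circle_cont_const|exact hP].
    * intros t ht. rewrite !Cmod_mult, Cmod_m1, Rmult_1_l.
      apply Rmult_le_compat; try apply Cmod_ge_0; [|now apply hM].
      replace (F (cis t) + - (1) * P (cis t)) with (F (cis t) - P (cis t)) by ring.
      apply unif, Cmod_cis.
  + apply Rle_lt_trans with (e' * (M + 1))%R; [nra|]. unfold e'.
    replace (eps / (M + 1) / 2 * (M + 1))%R with (eps / 2)%R by (field; lra). lra.
- assert (E1 : mean (fun z => P z * G z) = lsum (fun i => (f i * mean (fun z => (z ^^ e i * G z)%C))%C) L).
  { rewrite (mean_ext _ (fun z => lsum (fun i => f i * (z ^^ e i * G z)) L)).
    - rewrite (mean_lsum (fun i z => f i * (z ^^ e i * G z))).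
      + apply lsum_ext; intros i _. now apply mean_scal.
      + intros i. apply circle_cont_mult; [apply circle_cont_const|apply cg].
    - intros z _. unfold P. rewrite Cmult_comm, <- lsum_scal. apply lsum_ext; intros; ring. }
  rewrite <- E1.
  assert (c1 := circle_cont_mult _ _ hF hG). assert (c2 := circle_cont_mult _ _ hP hG).
  assert (c3 := circle_cont_mult _ _ (circle_cont_const (- (1))) c1).
  rewrite (mean_ext _ (fun z => P z * G z + - (1) * (F z * G z))) by (intros; ring).
  rewrite mean_plus, mean_scal by assumption. ring.
Qed.

End Lists.

(** * Laurent expansions *)

Lemma Ccont_comp (H : C -> C) (phi : R -> C) (t : R) (l : C) :
  Cder H (phi t) l -> Ccont phi t -> Ccont (fun s => H (phi s)) t.
Proof.
intros hH hphi. apply Ccont_eps; intros eps heps.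
destruct (Cder_cont H _ l hH eps heps) as (d & hd & Hd).
destruct (proj1 (Ccont_eps _ _) hphi d hd) as (r & hr & Hr).
exists r; split; [exact hr|]; intros s hs. apply Hd, Hr, hs.
Qed.

(* [g] is the difference quotient of [f] at 1, continued by the derivative. *)
Lemma quotient_at_1 (f : C -> C) : holomorphic f ->
  exists g, circle_cont g /\ forall w, Cmod w = 1%R -> f w = f 1 + (w * g w - g w).
Proof.
intros hf. assert (h1 : (1 : C) <> 0) by (rewrite <- cis_0; apply cis_neq_0).
destruct (hf 1 h1) as [l hl]. apply Cder_is_derive in hl.
pose (g := fun w => if Req_EM_T (Cmod (w - 1)) 0 then l else (f w - f 1) * / (w - 1)).
exists g; split.
- intros t. assert (ht := circle_cont_powz 1 t). simpl in ht.
  assert (hcis : Ccont cis t) by (apply Ccont_ext with (2 := ht); intros s; ring).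
  destruct (Req_EM_T (Cmod (cis t - 1)) 0) as [e|e].
  + apply Ccont_eps; intros eps heps.
    assert (e1 : cis t = 1).
    { apply Cmod_eq_0 in e. replace (cis t) with (cis t - 1 + 1) by ring. rewrite e; ring. }
    destruct (hl (eps / 2)%R ltac:(lra)) as (d & hd & Hd).
    destruct (proj1 (Ccont_eps _ _) hcis d hd) as (r & hr & Hr).
    exists r; split; [exact hr|]; intros s hs. specialize (Hr s hs). rewrite e1 in *.
    unfold g at 2. destruct (Req_EM_T (Cmod (1 - 1)) 0) as [_|k]; [|contradiction].
    unfold g. destruct (Req_EM_T (Cmod (cis s - 1)) 0) as [_|k].
    * replace (l - l) with (RtoC 0) by ring. rewrite Cmod_0; exact heps.
    * specialize (Hd _ Hr).
      assert (kp := Cmod_ge_0 (cis s - 1)). assert (k0 : cis s - 1 <> 0) by (apply Cmod_gt_0; lra).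
      replace ((f (cis s) - f 1) * / (cis s - 1) - l) with
        ((f (cis s) - f 1 - l * (cis s - 1)) * / (cis s - 1)) by (field; exact k0).
      rewrite Cmod_mult, Cmod_inv by exact k0.
      apply Rmult_lt_reg_r with (Cmod (cis s - 1)); [lra|].
      rewrite Rmult_assoc, Rinv_l, Rmult_1_r by exact k. nra.
  + assert (kp := Cmod_ge_0 (cis t - 1)). assert (k0 : cis t - 1 <> 0) by (apply Cmod_gt_0; lra).
    assert (hc1 : Ccont (fun s => cis s - 1) t) by (apply Ccont_plus; [exact hcis|apply Ccont_const]).
    assert (hq : Ccont (fun s => (f (cis s) - f 1) * / (cis s - 1)) t).
    { apply Ccont_mult.
      - apply Ccont_plus; [apply (holomorphic_circle_cont f hf)|apply Ccont_const].
      - apply (Ccont_comp Cinv (fun s => cis s - 1) t (- / ((cis t - 1) * (cis t - 1)))); [|exact hc1].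
        apply Cder_is_derive, is_derive_Cinv, k0. }
    apply Ccont_eps; intros eps heps.
    destruct (proj1 (Ccont_eps _ _) hq eps heps) as (r & hr & Hr).
    (* Closer to [cis t] than the point 1 is, the function g is given by the quotient. *)
    destruct (proj1 (Ccont_eps _ _) hc1 (Cmod (cis t - 1)) ltac:(lra)) as (r' & hr' & Hr').
    exists (Rmin r r'); split; [now apply Rmin_pos|]. intros s hs.
    specialize (Hr s (Rlt_le_trans _ _ _ hs (Rmin_l _ _))).
    specialize (Hr' s (Rlt_le_trans _ _ _ hs (Rmin_r _ _))).
    unfold g. destruct (Req_EM_T (Cmod (cis t - 1)) 0) as [k|_]; [contradiction|].
    destruct (Req_EM_T (Cmod (cis s - 1)) 0) as [k|_]; [|exact Hr].
    apply Cmod_eq_0 in k. rewrite k in Hr'.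
    replace (0 - (cis t - 1)) with (- (cis t - 1)) in Hr' by ring. rewrite Cmod_opp in Hr'. lra.
- intros w _. unfold g. destruct (Req_EM_T (Cmod (w - 1)) 0) as [k|k].
  + apply Cmod_eq_0 in k. assert (e : w = 1) by (replace w with (w - 1 + 1) by ring; rewrite k; ring).
    rewrite e. ring.
  + assert (k0 : w - 1 <> 0) by (intros e; rewrite e, Cmod_0 in k; contradiction).
    field; exact k0.
Qed.

(** Each stage adds just the two extreme indices, so the symmetric partial sums telescope by
    induction on N. *)
Fixpoint zball (N : nat) : list Z :=
  match N with
  | O => [0%Z]
  | S N' => Z.of_nat N :: (- Z.of_nat N)%Z :: zball N'
  end.

Lemma in_zball (N : nat) (n : Z) : In n (zball N) <-> (Z.abs n <= Z.of_nat N)%Z.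
Proof.
induction N as [|N IH].
- simpl. lia.
- change (In n (zball (S N))) with
    (Z.of_nat (S N) = n \/ (- Z.of_nat (S N))%Z = n \/ In n (zball N)).
  rewrite IH. lia.
Qed.

Lemma NoDup_zball (N : nat) : NoDup (zball N).
Proof.
induction N as [|N IH]; [repeat constructor; simpl; tauto|].
change (zball (S N)) with (Z.of_nat (S N) :: (- Z.of_nat (S N))%Z :: zball N).
constructor; [|constructor; [|exact IH]].
- intros [h|h]; [lia|]. apply in_zball in h. lia.
- intros h. apply in_zball in h. lia.
Qed.

Lemma zball_bound (l : list Z) : exists K, incl l (zball K).
Proof.
induction l as [|n l [K hK]].
- exists 0%nat; intros ? [].
- exists (Nat.max K (Z.to_nat (Z.abs n))). intros j [<-|hj].
  + apply in_zball. lia.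
  + apply in_zball. specialize (hK j hj). apply in_zball in hK. lia.
Qed.

Definition halfpow (n : Z) : R := ((/ 2) ^ Z.to_nat (Z.abs n))%R.

Lemma rsum_halfpow_zball (N : nat) : (rsum halfpow (zball N) = 3 - 2 * (/ 2) ^ N)%R.
Proof.
induction N as [|N IH].
- unfold rsum, halfpow; simpl; lra.
- change (zball (S N)) with (Z.of_nat (S N) :: (- Z.of_nat (S N))%Z :: zball N).
  change (rsum halfpow (?a :: ?b :: ?l)) with (halfpow a + (halfpow b + rsum halfpow l))%R.
  rewrite IH. unfold halfpow. rewrite Z.abs_opp, Z.abs_eq, Nat2Z.id by lia.
  simpl. lra.
Qed.

Lemma halfpow_pos (n : Z) : (0 <= halfpow n)%R.
Proof. unfold halfpow; apply pow_le; lra. Qed.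

(** The indices of r lie in some [zball K] and outside [zball N], so the sum is at most the
    difference of the two closed forms. *)
Lemma rsum_halfpow_tail (N : nat) (r : list Z) : NoDup (zball N ++ r) ->
  (rsum halfpow r <= 2 * (/ 2) ^ N)%R.
Proof.
intros h. destruct (zball_bound (zball N ++ r)) as [K hK].
destruct (incl_Permutation _ _ h hK) as [u hu].
assert (e := rsum_perm halfpow _ _ hu). rewrite !rsum_app, !rsum_halfpow_zball in e.
assert (p := rsum_pos halfpow u halfpow_pos).
assert (q : (0 < (/ 2) ^ K)%R) by (apply pow_lt; lra). lra.
Qed.

Lemma Cmod_powz (z : C) (n : Z) : z <> 0 -> Cmod (z ^^ n) = powerRZ (Cmod z) n.
Proof.
intros hz. destruct n as [|p|p]; simpl.
- apply Cmod_1.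
- apply Cmod_pow.
- rewrite Cmod_inv, Cmod_pow by (now apply Cpow_ne). reflexivity.
Qed.

(** The bound on the circle of radius 2|z| gives the factor 2^(-n) for n > 0, and the bound on the
    circle of radius |z|/2 gives it for n < 0. *)
Lemma fourier_decay (F : C -> C) (z : C) : z <> 0 -> holomorphic F ->
  exists M, (0 <= M)%R /\ forall n, (Cmod (fourier F n * z ^^ n) <= M * halfpow n)%R.
Proof.
intros hz hF.
assert (h2 : RtoC 2 <> 0) by (intros h; apply (f_equal fst) in h; simpl in h; lra).
assert (hi : / RtoC 2 <> 0) by (intros h; apply (f_equal (Cmult 2)) in h; rewrite Cinv_r, Cmult_0_r in h by exact h2; apply (f_equal fst) in h; simpl in h; lra).
destruct (fourier_bound F (2 * z) (Cmult_neq_0 _ _ h2 hz) hF) as (M1 & p1 & H1).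
destruct (fourier_bound F (/ 2 * z) (Cmult_neq_0 _ _ hi hz) hF) as (M2 & p2 & H2).
exists (M1 + M2)%R; split; [lra|]. intros n.
specialize (H1 n). specialize (H2 n).
rewrite Cpowz_mult, Cmult_assoc, (Cmult_comm _ (2 ^^ n)), <- Cmult_assoc, Cmod_mult in H1 by assumption.
rewrite Cpowz_mult, Cmult_assoc, (Cmult_comm _ ((/ 2) ^^ n)), <- Cmult_assoc, Cmod_mult in H2 by assumption.
set (X := Cmod (fourier F n * z ^^ n)) in *. assert (hX : (0 <= X)%R) by apply Cmod_ge_0.
rewrite Cmod_powz, Cmod_R, Rabs_pos_eq in H1 by (try assumption; lra).
rewrite Cmod_powz, Cmod_inv, Cmod_R, Rabs_pos_eq in H2 by (try assumption; lra).
assert (key : exists Y, (0 <= Y)%R /\ (X * 2 ^ Z.to_nat (Z.abs n) <= Y)%R /\ (Y <= M1 + M2)%R).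
{ destruct n as [|p|p].
  - exists X. simpl in *. lra.
  - exists M1. simpl in *. split; [lra|]. rewrite Rmult_comm. split; [exact H1|lra].
  - exists M2. simpl in *. split; [lra|]. rewrite Rmult_comm. split; [|lra].
    rewrite pow_inv, Rinv_inv in H2. exact H2. }
destruct key as (Y & _ & k1 & k2). unfold halfpow. rewrite pow_inv.
assert (p := pow_lt 2 (Z.to_nat (Z.abs n)) ltac:(lra)).
apply Rmult_le_reg_r with (2 ^ Z.to_nat (Z.abs n))%R; [exact p|].
rewrite Rmult_assoc, Rinv_l by lra. lra.
Qed.

Lemma circle_cont_dilate (F : C -> C) (z : C) : z <> 0 -> holomorphic F ->
  circle_cont (fun w => F (z * w)).
Proof. intros hz hF. now apply holomorphic_circle_cont, holomorphic_scale. Qed.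

(* With f(zw) = f(z) + (w-1) g(w), the Fourier coefficients telescope and
   the symmetric partial sums differ from f(z) by two coefficients of g. *)
Lemma fourier_partial_sum (F : C -> C) (z : C) : z <> 0 -> holomorphic F ->
  exists g, circle_cont g /\ forall N : nat,
    lsum (fun n => fourier F n * z ^^ n) (zball N) =
    F z + fourier g (- Z.of_nat N - 1) - fourier g (Z.of_nat N).
Proof.
intros hz hF.
destruct (quotient_at_1 _ (holomorphic_scale F z hz hF)) as (g & hg & hgE).
exists g; split; [exact hg|].
(* Multiplication by w shifts the coefficients of g by one. The constant F z contributes only at n =
   0, where the mean of w^(-n) is 1. *)
assert (key : forall n, fourier F n * z ^^ n =
  F z * mean (fun w => w ^^ (- n)) + fourier g (n - 1) - fourier g n).
{ intros n. rewrite <- fourier_dilate by assumption. unfold fourier.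
  assert (c0 := circle_cont_powz (- n)).
  assert (c1 := circle_cont_mult _ _ hg c0).
  assert (c2 := circle_cont_mult _ _ hg (circle_cont_powz (- (n - 1)))).
  assert (c3 := circle_cont_mult _ _ (circle_cont_const (F z)) c0).
  assert (c4 := circle_cont_mult _ _ (circle_cont_const (- (1))) c1).
  rewrite (mean_ext _ (fun w => (F z * w ^^ (- n) + g w * w ^^ (- (n - 1))) + - (1) * (g w * w ^^ (- n)))).
  - rewrite !mean_plus, !mean_scal by (try assumption; apply circle_cont_plus; assumption). ring.
  - intros w hw. rewrite hgE by exact hw.
    replace (- (n - 1))%Z with (1 + - n)%Z by lia.
    rewrite (Cpowz_add w) by (now apply Cmod1_neq_0). rewrite Cmult_1_r.
    change (w ^^ 1) with (w * 1). ring. }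
induction N as [|N IH].
- unfold lsum; simpl fold_right. rewrite key. simpl Z.of_nat. simpl Z.sub.
  change (mean (fun w => w ^^ (- 0))) with (mean (fun w => 1)). rewrite mean_const. ring.
- change (zball (S N)) with (Z.of_nat (S N) :: (- Z.of_nat (S N))%Z :: zball N).
  change (lsum ?f (?a :: ?b :: ?l)) with (f a + (f b + lsum f l)). cbv beta.
  rewrite IH, !key, !mean_powz by lia.
  replace (Z.of_nat (S N) - 1)%Z with (Z.of_nat N) by lia.
  replace (- Z.of_nat N - 1)%Z with (- Z.of_nat (S N))%Z by lia. ring.
Qed.

(** [fourier_partial_sum] identifies the limit, but only along symmetric intervals. The geometric
    decay bounds whatever a larger finite set adds, which upgrades this to unconditional
    convergence. *)
Theorem laurent (F : C -> C) : holomorphic F -> laurent_expansion F (fourier F).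
Proof.
intros hF z hz eps heps.
destruct (fourier_partial_sum F z hz hF) as (g & hg & hS).
destruct (fourier_decay F z hz hF) as (M & hM0 & hM).
destruct (riemann_lebesgue g hg (eps / 8)%R ltac:(lra)) as (N1 & HN1).
destruct (pow_lt_1_zero (/ 2)) with (y := (eps / 8 / (M + 1))%R) as [N2 HN2].
{ rewrite Rabs_pos_eq; lra. }
{ apply Rdiv_lt_0_compat; lra. }
pose (N := Nat.max N1 N2). specialize (HN2 N (Nat.le_max_r _ _)).
rewrite Rabs_pos_eq in HN2 by (apply pow_le; lra).
exists (zball N); split; [apply Forall_forall; auto|]. intros L hL _ hi.
destruct (incl_Permutation _ _ (NoDup_zball N) hi) as [r hr].
rewrite (lsum_perm _ _ _ hr), lsum_app, hS.
assert (b1 := HN1 (- Z.of_nat N - 1)%Z ltac:(lia)).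
assert (b2 := HN1 (Z.of_nat N) ltac:(lia)).
assert (b3 : (Cmod (lsum (fun n => (fourier F n * z ^^ n)%C) r) <= eps / 4)%R).
{ eapply Rle_trans; [apply Cmod_lsum|].
  eapply Rle_trans; [apply rsum_le with (g := fun n => (M * halfpow n)%R); intros; apply hM|].
  assert (t := rsum_halfpow_tail N r (Permutation_NoDup hr hL)).
  assert (e : rsum (fun n => (M * halfpow n)%R) r = (M * rsum halfpow r)%R).
  { clear. unfold rsum. induction r as [|i r IH]; simpl; [ring|]. rewrite IH; ring. }
  rewrite e. apply Rle_trans with (M * (2 * (/ 2) ^ N))%R; [apply Rmult_le_compat_l; assumption|].
  assert (p : (0 <= (/ 2) ^ N)%R) by (apply pow_le; lra).
  apply Rmult_lt_compat_r with (r := (M + 1)%R) in HN2; [|lra].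
  replace (eps / 8 / (M + 1) * (M + 1))%R with (eps / 8)%R in HN2 by (field; lra). nra. }
set (T := lsum _ r) in *.
replace (F z + fourier g (- Z.of_nat N - 1) - fourier g (Z.of_nat N) + T - F z) with
  (fourier g (- Z.of_nat N - 1) + - fourier g (Z.of_nat N) + T) by ring.
eapply Rle_lt_trans; [apply Cmod_triangle|].
eapply Rle_lt_trans; [apply Rplus_le_compat_r, Cmod_triangle|]. rewrite Cmod_opp. lra.
Qed.

(** * The Poisson bracket *)

Lemma lsum_zero {I : Type} (f : I -> C) (l : list I) :
  (forall i, In i l -> f i = 0) -> lsum f l = 0.
Proof.
intros h. rewrite (lsum_ext f (fun i => 0 * f i)); [rewrite lsum_scal; ring|].
intros i hi. rewrite h by exact hi. ring.
Qed.

Lemma lsum_single {I : Type} (f : I -> C) (l : list I) (i : I) : NoDup l -> In i l ->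
  (forall j, In j l -> j <> i -> f j = 0) -> lsum f l = f i.
Proof.
intros hl hi h. destruct (in_split i l hi) as (u & v & ->).
rewrite (lsum_perm f _ _ (Permutation_sym (Permutation_middle u v i))).
apply NoDup_remove_2 in hl.
change (f i + lsum f (u ++ v) = f i). rewrite lsum_zero; [ring|].
intros j hj. apply h.
- rewrite in_app_iff in *. simpl; tauto.
- intros ->; contradiction.
Qed.

Lemma has_sum_ext {I : Type} (A : I -> Prop) (f g : I -> C) (s : C) :
  (forall i, A i -> f i = g i) -> has_sum A f s -> has_sum A g s.
Proof.
intros h hs eps heps. destruct (hs eps heps) as (F0 & h0 & H). exists F0; split; [exact h0|].
intros F hF hA hi. rewrite <- (lsum_ext f g); [now apply H|].
intros i hiF. apply h. exact (proj1 (Forall_forall _ _) hA i hiF).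
Qed.

(** The section s : Z \ {0} -> A of p has the good indices as its image, and f vanishes on the
    others. The sum over A is thus the sum of g over Z, to which the index 0 adds nothing. *)
Lemma has_sum_reindex {I : Type} (A : I -> Prop) (good : I -> bool) (f : I -> C) (g : Z -> C)
    (p : I -> Z) (s : Z -> I) (c : C) :
  g 0%Z = 0 ->
  (forall i, A i -> p i <> 0%Z) ->
  (forall j, j <> 0%Z -> A (s j) /\ good (s j) = true /\ p (s j) = j) ->
  (forall i, A i -> good i = true -> s (p i) = i /\ f i = g (p i)) ->
  (forall i, A i -> good i = false -> f i = 0) ->
  has_sum (fun _ => True) g c -> has_sum A f c.
Proof.
intros hg0 hp hs hgood hbad h eps heps.
destruct (h eps heps) as (F0 & _ & H).
exists (map s (filter (fun j => negb (Z.eqb j 0)) F0)). split.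
{ apply Forall_forall; intros i hi. apply in_map_iff in hi. destruct hi as (j & <- & hj).
  apply filter_In in hj. destruct hj as [_ hj]. apply hs.
  intros ->. discriminate. }
intros F hF hA hi.
assert (hA' := proj1 (Forall_forall _ _) hA).
(* 0 is prepended because F0 may contain it, whereas p never takes this value on A. *)
specialize (H (0%Z :: map p (filter good F))).
assert (e : lsum g (0%Z :: map p (filter good F)) = lsum f F).
{ change (g 0%Z + lsum g (map p (filter good F)) = lsum f F). rewrite hg0, Cplus_0_l.
  clear - hA' hgood hbad. unfold lsum. induction F as [|i F IH]; [reflexivity|]; simpl.
  rewrite <- IH by (intros; apply hA'; now right).
  assert (hAi := hA' i (or_introl eq_refl)). destruct (good i) eqn:E; simpl.
  - now rewrite (proj2 (hgood i hAi E)).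
  - rewrite (hbad i hAi E); ring. }
rewrite e in H. apply H.
- constructor.
  + intros h0. apply in_map_iff in h0. destruct h0 as (i & h1 & h2). apply filter_In in h2.
    apply (hp i); [apply hA', h2|exact h1].
  + apply (NoDup_map_NoDup_ForallPairs); [|now apply NoDup_filter].
    intros i j h1 h2 h3. apply filter_In in h1. apply filter_In in h2.
    destruct (hgood i) as [<- _]; [apply hA', h1|apply h1|].
    destruct (hgood j) as [<- _]; [apply hA', h2|apply h2|]. now rewrite h3.
- apply Forall_forall; auto.
- intros j hj. destruct (Z.eq_dec j 0) as [->|hne]; [now left|right].
  apply in_map_iff. exists (s j). destruct (hs j hne) as (h1 & h2 & h3). split; [exact h3|].
  apply filter_In; split; [|exact h2]. apply hi. apply in_map. apply filter_In; split; [exact hj|].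
  apply Bool.negb_true_iff, Z.eqb_neq, hne.
Qed.

(** * Fourier coefficients of theta series and of their products with x *)

Section Theta.
Variables (q eta : C) (k : nat).
Hypothesis (hk : (1 <= k)%nat).
Let K := Z.of_nat k.

(** The coefficient of z^(2kl - m) in the theta series of index -m. *)
Definition theta_coef (m l : Z) : C :=
  q ^^ (- (m * l)) * q ^^ (K * l * (l - 1)) * eta ^^ (2 * K * l).

(** Termwise integration against z^(-v), where orthogonality leaves an indicator. At most one l
    meets it, so the sum is finite and is evaluated by uniqueness of sums in the two lemmas that
    follow. *)
Lemma fourier_theta (m : nat) (b : C -> C) (v : Z) : circle_cont b -> is_theta q eta k m b ->
  has_sum (fun _ => True)
    (fun l => theta_coef (Z.of_nat m) l * if Z.eq_dec (2 * K * l - Z.of_nat m) v then 1 else 0)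
    (fourier b v).
Proof.
intros hb hth.
apply has_sum_ext with (2 := has_sum_mean (theta_coef (Z.of_nat m))
  (fun l => 2 * K * l - Z.of_nat m)%Z b _ hb (circle_cont_powz (- v))
  (fun z hz => hth z (Cmod1_neq_0 z hz))).
intros l _. f_equal.
rewrite (mean_ext _ (fun z => z ^^ (2 * K * l - Z.of_nat m + - v))).
2:{ intros z hz. now rewrite Cpowz_add by (now apply Cmod1_neq_0). }
destruct (Z.eq_dec (2 * K * l - Z.of_nat m) v) as [e|e].
- rewrite e, Z.add_opp_diag_r. exact (mean_const 1).
- apply mean_powz. lia.
Qed.

Lemma fourier_theta_at (m : nat) (b : C -> C) (l : Z) : circle_cont b -> is_theta q eta k m b ->
  fourier b (2 * K * l - Z.of_nat m) = theta_coef (Z.of_nat m) l.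
Proof.
intros hb hth. apply (has_sum_unique _ _ _ _ (fourier_theta m b _ hb hth)).
match goal with |- has_sum _ ?g _ => set (f := g) end.
replace (theta_coef (Z.of_nat m) l) with (lsum f [l]).
- apply has_sum_finite.
  + repeat constructor; simpl; tauto.
  + repeat constructor.
  + intros i _ hi. unfold f. destruct (Z.eq_dec _ _) as [e|e]; [|ring].
    exfalso; apply hi; left. unfold K in e. nia.
- unfold lsum, f; simpl. destruct (Z.eq_dec _ _) as [e|e]; [ring|contradiction].
Qed.

Lemma fourier_theta_off (m : nat) (b : C -> C) (v : Z) : circle_cont b -> is_theta q eta k m b ->
  (forall l, (2 * K * l - Z.of_nat m)%Z <> v) -> fourier b v = 0.
Proof.
intros hb hth h. apply (has_sum_unique _ _ _ _ (fourier_theta m b _ hb hth)).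
change (RtoC 0) with (lsum (fun l => theta_coef (Z.of_nat m) l *
  if Z.eq_dec (2 * K * l - Z.of_nat m) v then 1 else 0) []).
apply has_sum_finite; [constructor|constructor|].
intros l _ _. destruct (Z.eq_dec _ _) as [e|e]; [now apply h in e|ring].
Qed.

Variable x : nat -> C.

Lemma coef_in (j : nat) : (j < 2 * k)%nat -> coef k x (Z.of_nat j) = x j.
Proof.
intros h. unfold coef.
rewrite (proj2 (Z.leb_le _ _)), (proj2 (Z.ltb_lt _ _)), Nat2Z.id by lia. reflexivity.
Qed.

(** The index w - 2kl lies in [0, 2k) only if l is the Euclidean quotient. This collapses the sums
    over l and t to one term each. *)
Lemma coef_out (w l : Z) : l <> (w / (2 * K))%Z -> coef k x (w - 2 * K * l) = 0.
Proof.
intros h. unfold coef.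
destruct (Z.leb_spec 0 (w - 2 * K * l)); [|reflexivity].
destruct (Z.ltb_spec (w - 2 * K * l) (2 * Z.of_nat k)); [|reflexivity].
exfalso; apply h. apply Z.div_unique with (w - 2 * K * l)%Z; unfold K in *; lia.
Qed.

(** The power z^u arises as z^(2kl - m) z^j with 0 <= j < 2k, that is m + u = 2kl + j. Euclidean
    division makes l the quotient and j the remainder. *)
Lemma fourier_theta_xpoly (m : nat) (b : C -> C) (u : Z) : circle_cont b -> is_theta q eta k m b ->
  let l := ((Z.of_nat m + u) / (2 * K))%Z in
  fourier (fun z => b z * xpoly k x z) u =
  theta_coef (Z.of_nat m) l * coef k x (Z.of_nat m + u - 2 * K * l).
Proof.
intros hb hth l.
assert (hj : forall v, circle_cont (fun z => b z * z ^^ v))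
  by (intros; apply circle_cont_mult; [exact hb|apply circle_cont_powz]).
assert (e : fourier (fun z => b z * xpoly k x z) u =
  lsum (fun j => x j * fourier b (u - Z.of_nat j)) (seq 0 (2 * k))).
{ unfold fourier.
  rewrite (mean_ext _ (fun z => lsum (fun j => x j * (b z * z ^^ (- (u - Z.of_nat j)))) (seq 0 (2 * k)))).
  - rewrite (mean_lsum (fun j z => x j * (b z * z ^^ (- (u - Z.of_nat j))))).
    + apply lsum_ext; intros j _. now rewrite mean_scal.
    + intros j. apply circle_cont_mult; [apply circle_cont_const|apply hj].
  - intros z hz. unfold xpoly.
    rewrite (Cmult_comm (b z)), <- Cmult_assoc, Cmult_comm, <- lsum_scal.
    apply lsum_ext; intros j _.
    replace (- (u - Z.of_nat j))%Z with (Z.of_nat j + - u)%Z by lia.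
    rewrite (Cpowz_add z), Cpowz_nat by (now apply Cmod1_neq_0). ring. }
rewrite e.
assert (hd := Z.div_mod (Z.of_nat m + u) (2 * K) ltac:(unfold K; lia)). fold l in hd.
assert (hr := Z.mod_pos_bound (Z.of_nat m + u) (2 * K) ltac:(unfold K; lia)).
set (r := ((Z.of_nat m + u) mod (2 * K))%Z) in *.
pose (j0 := Z.to_nat r).
assert (hj0 : Z.of_nat j0 = r) by (unfold j0; lia).
rewrite (lsum_single _ _ j0).
- replace (u - Z.of_nat j0)%Z with (2 * K * l - Z.of_nat m)%Z by lia.
  rewrite fourier_theta_at by assumption.
  replace (Z.of_nat m + u - 2 * K * l)%Z with (Z.of_nat j0) by lia.
  rewrite coef_in by (unfold K in *; lia). ring.
- apply seq_NoDup.
- apply in_seq. unfold K in *; lia.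
- intros j hjs hne. apply in_seq in hjs.
  rewrite (fourier_theta_off m b _ hb hth); [ring|].
  intros l' el. assert (el' : (Z.of_nat m + u = 2 * K * l' + Z.of_nat j)%Z) by lia.
  assert (h := Z.mod_unique (Z.of_nat m + u) (2 * K) l' (Z.of_nat j) ltac:(unfold K; lia) el').
  fold r in h. lia.
Qed.

End Theta.

(** * q-difference equations and the trace in the pairing *)

Lemma Cpowz_neq_1 (q : C) (u : Z) : q <> 0 -> (Cmod q < 1)%R -> u <> 0%Z -> q ^^ u - 1 <> 0.
Proof.
assert (key : forall (p : positive), (Cmod q < 1)%R -> (Cmod q ^ Pos.to_nat p < 1)%R).
{ intros p h. apply pow_lt_1_compat; [split; [apply Cmod_ge_0|exact h]|apply Pos2Nat.is_pos]. }
intros h0 h1 hu e.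
assert (e1 : q ^^ u = 1) by (replace (q ^^ u) with (q ^^ u - 1 + 1) by ring; rewrite e; ring).
apply (f_equal Cmod) in e1. rewrite Cmod_1 in e1.
destruct u as [|p|p]; [contradiction| |]; simpl in e1; specialize (key p h1).
- rewrite Cmod_pow in e1. lra.
- rewrite Cmod_inv, Cmod_pow in e1 by (now apply Cpow_ne).
  apply (f_equal Rinv) in e1. rewrite Rinv_inv, Rinv_1 in e1. lra.
Qed.

Lemma fourier_plus (F G : C -> C) (n : Z) : circle_cont F -> circle_cont G ->
  fourier (fun z => F z + G z) n = fourier F n + fourier G n.
Proof.
intros hF hG. unfold fourier. assert (hp := circle_cont_powz (- n)).
rewrite (mean_ext _ (fun z => F z * z ^^ (- n) + G z * z ^^ (- n))) by (intros; ring).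
apply mean_plus; apply circle_cont_mult; assumption.
Qed.

Lemma fourier_scal (F : C -> C) (c : C) (n : Z) : circle_cont F ->
  fourier (fun z => c * F z) n = c * fourier F n.
Proof.
intros hF. unfold fourier. assert (hp := circle_cont_powz (- n)).
rewrite (mean_ext _ (fun z => c * (F z * z ^^ (- n)))) by (intros; ring).
apply mean_scal; apply circle_cont_mult; assumption.
Qed.

Lemma fourier_ext (F G : C -> C) (n : Z) : (forall z : C, z <> 0 -> F z = G z) -> fourier F n = fourier G n.
Proof. intros h. apply mean_ext; intros z hz. rewrite h by (now apply Cmod1_neq_0). reflexivity. Qed.

Lemma fourier_diff_0 (F : C -> C) (q : C) : q <> 0 -> holomorphic F ->
  fourier (fun z => F (q * z) + - (1) * F z) 0 = 0.
Proof.
intros hq hF. assert (c := holomorphic_circle_cont F hF).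
rewrite fourier_plus, fourier_scal, fourier_dilate; auto.
- simpl; ring.
- now apply circle_cont_dilate.
- apply circle_cont_mult; [apply circle_cont_const|exact c].
Qed.

Lemma fourier_q_difference (a h : C -> C) (q : C) (v : Z) : q <> 0 -> (Cmod q < 1)%R ->
  v <> 0%Z -> holomorphic a -> circle_cont h ->
  (forall z : C, z <> 0 -> a (q * z) - a z = - h z) ->
  fourier a v = - fourier h v / (q ^^ v - 1).
Proof.
intros hq0 hq1 hv ha hh e.
assert (hne := Cpowz_neq_1 q v hq0 hq1 hv).
assert (ca := holomorphic_circle_cont a ha). assert (caq := circle_cont_dilate a q hq0 ha).
assert (e1 : fourier (fun z => a (q * z)) v = fourier a v + - (1) * fourier h v).
{ rewrite <- fourier_scal, <- fourier_plus; auto.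
  - apply fourier_ext. intros z hz.
    replace (a (q * z)) with (a (q * z) - a z + a z) by ring. rewrite (e z hz); ring.
  - apply circle_cont_mult; [apply circle_cont_const|exact hh]. }
rewrite fourier_dilate in e1 by assumption.
replace (fourier h v) with (fourier a v - fourier a v * q ^^ v) by (rewrite e1; ring).
field; exact hne.
Qed.

(** Write e for the upper left entry of A(qz). The relation a(qz) = a - b x absorbs both cross
    terms: -2 e x b turns 2 e a into 2 e a(qz), and - b_m x^2 b turns 2 b_m x a into b_m x (a +
    a(qz)). The invariance of b cancels the factor (eta z)^(-2k) in front of the lower left
    entry. *)
Lemma trace_connecting (q eta : C) (k : nat) (x : nat -> C) (A : C -> M2) (bm a b : C -> C) (D : C -> M2) (z : C) :
  q <> 0 -> eta <> 0 -> z <> 0 ->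
  (forall z : C, z <> 0 -> mtrace (A z) = 0) ->
  (forall z : C, z <> 0 -> entry (A z) 0 1 = bm z) ->
  (forall z : C, z <> 0 -> (eta * z) ^ (2 * k) * bm (q * z) = bm z) ->
  (forall z : C, z <> 0 -> D z = mat2 (a z) (b z) 0 (- a z)) ->
  (forall z : C, z <> 0 -> (eta * z) ^ (2 * k) * b (q * z) = b z) ->
  (forall z : C, z <> 0 -> a (q * z) - a z = - (b z * xpoly k x z)) ->
  mtrace (mmul (cobound q eta k x A z) (D z)) =
  2 * (entry (A (q * z)) 0 0 * a (q * z) + - (1) * (entry (A z) 0 0 * a z)) +
  (entry (A (q * z)) 1 0 * b (q * z) + - (1) * (entry (A z) 1 0 * b z)) +
  bm z * xpoly k x z * (a z + a (q * z)).
Proof.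
intros hq heta hz htr hb01 hbm hD hb ha.
assert (hqz : q * z <> 0) by now apply Cmult_neq_0.
assert (hf : (eta * z) ^ (2 * k) <> 0) by (apply Cpow_ne; now apply Cmult_neq_0).
unfold cobound. rewrite adqE by assumption. rewrite (mat2_eta (A z)), msub_mat2, (hD z hz), mmul_mat2.
change (mtrace (mat2 ?s ?t ?u ?v)) with (s + v).
change (entry (mat2 ?s ?t ?u ?v) 0 0) with s. change (entry (mat2 ?s ?t ?u ?v) 1 0) with u.
assert (t1 := htr z hz). assert (t2 := htr _ hqz). unfold mtrace in t1, t2.
specialize (hbm z hz). specialize (hb z hz). specialize (ha z hz).
rewrite (hb01 _ hqz), (hb01 _ hz).
set (f := (eta * z) ^ (2 * k)) in *.
set (y := xpoly k x z) in *.
(* Eliminating the lower right entries, a(qz), b(z) and b_m(z) leaves a rational identity in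
   independent quantities, with f as the only denominator. *)
replace (entry (A z) 1 1) with (- entry (A z) 0 0)
  by (replace (entry (A z) 1 1) with (entry (A z) 0 0 + entry (A z) 1 1 - entry (A z) 0 0) by ring; rewrite t1; ring).
replace (entry (A (q * z)) 1 1) with (- entry (A (q * z)) 0 0)
  by (replace (entry (A (q * z)) 1 1) with (entry (A (q * z)) 0 0 + entry (A (q * z)) 1 1 - entry (A (q * z)) 0 0) by ring; rewrite t2; ring).
replace (a (q * z)) with (a z - b z * y)
  by (replace (a (q * z)) with (a (q * z) - a z + a z) by ring; rewrite ha; ring).
rewrite <- hb, <- hbm. field. exact hf.
Qed.

Theorem mainTheorem5
  (q eta : C) (k m n : nat) (x : nat -> C) (Dm Dn : C -> M2)
  (hq0 : q <> 0) (hq1 : (Cmod q < 1)%R) (heta : eta <> 0) (hk : (1 <= k)%nat)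
  (hm : (m < 2 * k)%nat) (hn : (n < 2 * k)%nat)
  (hx : exists j : nat, (j < 2 * k)%nat /\ x j <> 0)
  (hxm : x m = 0) (hxn : x n = 0)
  (hDm : is_dtheta q eta k x m Dm) (hDn : is_dtheta q eta k x n Dn) :
  exists c : C,
    pairing (Bsharp q eta k x Dm) Dn c /\
    has_sum
      (fun '((u, l, t) : Z * Z * Z) => u <> 0%Z)
      (fun '((u, l, t) : Z * Z * Z) =>
         let k' := Z.of_nat k in
         let m' := Z.of_nat m in
         let n' := Z.of_nat n in
         (q ^^ u + 1) / (q ^^ u - 1) *
         q ^^ (- (m' * l + n' * t)) *
         q ^^ (k' * (l * (l - 1) + t * (t - 1))) *
         eta ^^ (2 * k' * (l + t)) *
         coef k x (m' + u - 2 * k' * l) * coef k x (n' - u - 2 * k' * t))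
      c.
Proof.
destruct hDm as [(am & bm & _ & hbm & hDm1 & hbmq & _) thm].
destruct hDn as [(a & b & ha & hb & hDn1 & hbq & haq) thn].
(* [tau Dm] and [bm] may differ at 0, so the two are exchanged pointwise on the punctured plane. *)
assert (taum : forall z : C, z <> 0 -> tau Dm z = bm z)
  by (intros z hz; unfold tau; rewrite (hDm1 z hz); reflexivity).
assert (thm' : is_theta q eta k m bm) by (intros z hz; rewrite <- (taum z hz); exact (thm z hz)).
assert (thn' : is_theta q eta k n b).
{ intros z hz. assert (h := thn z hz). unfold tau in h. rewrite (hDn1 z hz) in h. exact h. }
clear thm thn.
assert (hy := holomorphic_xpoly k x).
pose (phi := fun z => bm z * xpoly k x z).
pose (psi := fun z => a z + a (q * z)).
pose (h := fun z => b z * xpoly k x z).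
assert (hphi : holomorphic phi) by (apply holomorphic_mult; assumption).
assert (haq' : holomorphic (fun z => a (q * z))) by (apply holomorphic_scale; assumption).
assert (hpsi : holomorphic psi) by (apply holomorphic_plus; assumption).
assert (hh : holomorphic h) by (apply holomorphic_mult; assumption).
assert (cphi := holomorphic_circle_cont _ hphi). assert (cpsi := holomorphic_circle_cont _ hpsi).
assert (ch := holomorphic_circle_cont _ hh). assert (ca := holomorphic_circle_cont _ ha).
assert (caq := holomorphic_circle_cont _ haq').
exists (fourier (fun z => phi z * psi z) 0). split; [split|].
- destruct (connecting_class q eta k x heta bm (conj hbm hbmq)) as (P & gP & HP).
  exists P.
  assert (hc : connecting q eta k x bm P).
  (* P belongs to its own class: P - P is the coboundary of the zero cochain. This shows that the
     set of representatives is nonempty. *)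
  { apply HP. split; [exact gP|]. exists (fun _ => mat2 0 0 0 0). split; [split; [split|]|].
    - intros [|[|i]] [|[|j]] hi hj; try lia; apply holomorphic_cst.
    - intros z _. change (RtoC 0 + 0 = 0). ring.
    - reflexivity.
    - intros z hz. unfold cobound. rewrite adqE by assumption.
      rewrite (mat2_eta (P z)), !msub_mat2.
      change (entry (mat2 0 0 0 0) 0 0) with (RtoC 0). change (entry (mat2 0 0 0 0) 0 1) with (RtoC 0).
      change (entry (mat2 0 0 0 0) 1 0) with (RtoC 0). change (entry (mat2 0 0 0 0) 1 1) with (RtoC 0).
      apply mat2_ext; ring. }
  destruct hc as (h1 & A & h2 & h3 & h4). split; [exact h1|]. exists A; split; [exact h2|]. split; [|exact h4].
  intros z hz. rewrite (h3 z hz). symmetry; now apply taum.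
(* Here A is an arbitrary lift. Its other entries survive only in the q-differences [dal] and [dga],
   so every representative has the same constant coefficient. *)
- intros P (_ & A & (hA & htr) & hA01 & hP).
  pose (al := fun z => entry (A z) 0 0 * a z). pose (ga := fun z => entry (A z) 1 0 * b z).
  assert (hal : holomorphic al) by (apply holomorphic_mult; [apply hA; lia|exact ha]).
  assert (hga : holomorphic ga) by (apply holomorphic_mult; [apply hA; lia|exact hb]).
  pose (dal := fun z => al (q * z) + - (1) * al z).
  pose (dga := fun z => ga (q * z) + - (1) * ga z).
  assert (hdal : holomorphic dal)
    by (apply holomorphic_plus; [now apply holomorphic_scale|apply holomorphic_mult; [apply holomorphic_cst|exact hal]]).
  assert (hdga : holomorphic dga)
    by (apply holomorphic_plus; [now apply holomorphic_scale|apply holomorphic_mult; [apply holomorphic_cst|exact hga]]).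
  assert (h2dal : holomorphic (fun z => 2 * dal z)) by (apply holomorphic_mult; [apply holomorphic_cst|exact hdal]).
  assert (hpp : holomorphic (fun z => phi z * psi z)) by (now apply holomorphic_mult).
  assert (hdd : holomorphic (fun z => 2 * dal z + dga z)) by (now apply holomorphic_plus).
  pose (W := fun z => (2 * dal z + dga z) + phi z * psi z).
  assert (hW : holomorphic W) by (now apply holomorphic_plus).
  exists (fourier W). split.
  + intros z hz. replace (mtrace (mmul (P z) (Dn z))) with (W z); [exact (laurent W hW z hz)|].
    rewrite (hP z hz). symmetry. apply (trace_connecting q eta k x A bm a b); try assumption.
    intros w hw. rewrite (hA01 w hw). now apply taum.
  + unfold W.
    rewrite (fourier_plus (fun z => 2 * dal z + dga z) (fun z => phi z * psi z)),
      (fourier_plus (fun z => 2 * dal z) dga), (fourier_scal dal)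
      by (now apply holomorphic_circle_cont).
    unfold dal, dga. rewrite !fourier_diff_0 by assumption. ring.
- pose (K := Z.of_nat k).
  pose (L := fun u => ((Z.of_nat m + u) / (2 * K))%Z).
  pose (T := fun u => ((Z.of_nat n - u) / (2 * K))%Z).
  assert (cbm := holomorphic_circle_cont _ hbm). assert (cb := holomorphic_circle_cont _ hb).
  assert (Ephi : forall u, fourier phi u =
     theta_coef q eta k (Z.of_nat m) (L u) * coef k x (Z.of_nat m + u - 2 * K * L u))
    by (intros u; exact (fourier_theta_xpoly q eta k hk x m bm u cbm thm')).
  (* The lemma at exponent - u speaks of n + - u, to which n - u unfolds. *)
  assert (Eh : forall u, fourier h (- u) =
     theta_coef q eta k (Z.of_nat n) (T u) * coef k x (Z.of_nat n - u - 2 * K * T u))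
    by (intros u; exact (fourier_theta_xpoly q eta k hk x n b (- u) cb thn')).
  (* The mean picks out the coefficient of psi at - u, which is (1 + q^(-u)) a_(-u) with a_(-u) = -
     h_(-u) / (q^(-u) - 1). Clearing q^(-u) gives the stated factor and its sign. *)
  assert (Epsi : forall u, u <> 0%Z ->
     mean (fun z => z ^^ u * psi z) = (q ^^ u + 1) / (q ^^ u - 1) * fourier h (- u)).
  { intros u hu. rewrite (mean_ext _ (fun z => psi z * z ^^ (- - u)))
      by (intros; rewrite Z.opp_involutive; ring).
    change (fourier psi (- u) = (q ^^ u + 1) / (q ^^ u - 1) * fourier h (- u)).
    unfold psi. rewrite fourier_plus, fourier_dilate by assumption.
    rewrite (fourier_q_difference a h q (- u)) by (try assumption; lia).
    assert (n1 := Cpowz_neq_1 q u hq0 hq1 hu).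
    assert (n2 := Cpowz_neq_1 q (- u) hq0 hq1 ltac:(lia)).
    assert (n3 := Cpowz_neq_0 q u hq0).
    rewrite Cpowz_opp in * by exact hq0.
    assert (n4 : 1 - q ^^ u <> 0).
    { intros e. apply n1. replace (q ^^ u - 1) with (- (1 - q ^^ u)) by ring. rewrite e; ring. }
    field. auto. }
  replace (fourier (fun z => phi z * psi z) 0) with (mean (fun z => phi z * psi z))
    by (apply mean_ext; intros; simpl; ring).
  (* For fixed u only the triple (u, L u, T u) can contribute; [coef_out] kills every other pair (l,
     t). *)
  apply (has_sum_reindex _
    (fun '(u, l, t) => (Z.eqb l (L u) && Z.eqb t (T u))%bool) _
    (fun u => fourier phi u * mean (fun z => z ^^ u * psi z))
    (fun '(u, l, t) => u) (fun u => (u, L u, T u))).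
  (* As m < 2k the quotient L 0 is 0, so the coefficient of phi at 0 is a multiple of x_m. *)
  + rewrite Ephi. unfold L. rewrite Z.add_0_r, Z.div_small by (unfold K; lia).
    rewrite Z.mul_0_r, Z.sub_0_r, coef_in, hxm by assumption. ring.
  + intros [[u l] t] hu; exact hu.
  + intros u hu. split; [exact hu|]. rewrite !Z.eqb_refl. auto.
  + intros [[u l] t] hu hg. apply Bool.andb_true_iff in hg. destruct hg as [e1 e2].
    apply Z.eqb_eq in e1, e2. subst l t. split; [reflexivity|].
    rewrite Epsi, Ephi, Eh by exact hu. fold K. cbv zeta.
    set (l := L u). set (t := T u). unfold theta_coef. fold K.
    replace (- (Z.of_nat m * l + Z.of_nat n * t))%Z
      with (- (Z.of_nat m * l) + - (Z.of_nat n * t))%Z by ring.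
    replace (K * (l * (l - 1) + t * (t - 1)))%Z with (K * l * (l - 1) + K * t * (t - 1))%Z by ring.
    replace (2 * K * (l + t))%Z with (2 * K * l + 2 * K * t)%Z by ring.
    rewrite !Cpowz_add by assumption. ring.
  + intros [[u l] t] hu hg. cbv zeta. fold K. apply Bool.andb_false_iff in hg. destruct hg as [e|e]; apply Z.eqb_neq in e.
    * assert (e' := coef_out k hk x (Z.of_nat m + u) l e). fold K in e'. rewrite e'. ring.
    * assert (e' := coef_out k hk x (Z.of_nat n - u) t e). fold K in e'. rewrite e'. ring.
  (* The Laurent series of phi is integrated against psi, which stays unexpanded under the mean. *)
  + apply (has_sum_mean (fourier phi) (fun u => u) phi psi cphi cpsi).
    intros z hz. exact (laurent phi hphi z (Cmod1_neq_0 z hz)).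
Qed.
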